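(* Let $M$ be a model of DOAG (the theory of non-trivial divisible ordered Abelian groups), and let $A\le B$ and $A\le C$ be $\mathbb{Q}$-vector subspaces of $M$, where $M$ is $|B\cup C|^+$-saturated and strongly $|B\cup C|^+$-homogeneous. Then $C\downarrow^{\mathrm{inv}}_A B$ if and only if $C\downarrow^{\mathrm{cut}}_A B$.
   Context: $C\downarrow^{\mathrm{inv}}_A B$ means: for every finite tuple $c$ from $C$, the type $\mathrm{tp}(c/A\cup B)$ extends to a complete global type over $M$ which is invariant under the action of $\mathrm{Aut}(M/A)$. $C\downarrow^{\mathrm{cut}}_A B$ means: every closed bounded interval $[b_1,b_2]$ (with $b_1\le b_2$ in $B$) having a point in $C$ already has a point in $A$. *)

(* Defs.v *)
From mathcomp Require Import all_boot all_order all_algebra.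
From mathcomp Require Import boolp classical_sets functions cardinality.

Set Implicit Arguments.
Unset Strict Implicit.
Unset Printing Implicit Defensive.

Import Order.TTheory GRing.Theory Num.Theory.
Local Open Scope classical_set_scope.
Local Open Scope card_scope.
Local Open Scope ring_scope.

(* [porderZmodType] does not relate the order to the addition, hence
   [doag_addr]. *)
Record is_doag (M : porderZmodType) : Prop := IsDoag {
  doag_total : forall x y : M, (x <= y) || (y <= x);
  doag_addr : forall x y z : M, x <= y -> x + z <= y + z;
  doag_div : forall (n : nat) (x : M), (0 < n)%N -> exists y : M, y *+ n = x;
  doag_nontriv : exists x : M, x != 0 }.

(* First-order language {0, -, +, <} with the elements of [M] as additional
   constants. [formula M n] consists of the formulas whose free variables are
   among x_0, ..., x_(n-1); under a quantifier, x_0 is the bound variable and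
   the others are shifted by one. *)
Inductive term (M : Type) (n : nat) : Type :=
  | Var of 'I_n
  | Par of M
  | Zero
  | Opp of term M n
  | Add of term M n & term M n.

Inductive formula (M : Type) : nat -> Type :=
  | Eq n of term M n & term M n : formula M n
  | Lt n of term M n & term M n : formula M n
  | Not n of formula M n : formula M n
  | And n of formula M n & formula M n : formula M n
  | Ex n of formula M n.+1 : formula M n.

Fixpoint term_pars_in (M : Type) (D : set M) n (t : term M n) : Prop :=
  match t with
  | Var _ | Zero => True
  | Par a => D a
  | Opp u => term_pars_in D u
  | Add u w => term_pars_in D u /\ term_pars_in D w
  end.

Fixpoint pars_in (M : Type) (D : set M) n (phi : formula M n) : Prop :=
  match phi with
  | Eq _ t u | Lt _ t u => term_pars_in D t /\ term_pars_in D u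
  | Not _ psi => pars_in D psi
  | And _ psi chi => pars_in D psi /\ pars_in D chi
  | Ex _ psi => pars_in D psi
  end.

Fixpoint term_map (M : Type) (s : M -> M) n (t : term M n) : term M n :=
  match t with
  | Var i => Var M i
  | Par a => Par n (s a)
  | Zero => Zero M n
  | Opp u => Opp (term_map s u)
  | Add u w => Add (term_map s u) (term_map s w)
  end.

Fixpoint formula_map (M : Type) (s : M -> M) n (phi : formula M n) :
    formula M n :=
  match phi with
  | Eq _ t u => Eq (term_map s t) (term_map s u)
  | Lt _ t u => Lt (term_map s t) (term_map s u)
  | Not _ psi => Not (formula_map s psi)
  | And _ psi chi => And (formula_map s psi) (formula_map s chi)
  | Ex _ psi => Ex (formula_map s psi)
  end.

Definition scons (M : Type) n (x : M) (v : 'I_n -> M) (i : 'I_n.+1) : M :=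
  if unlift ord0 i is Some j then v j else x.

Section Semantics.
Variable M : porderZmodType.

Fixpoint eval n (v : 'I_n -> M) (t : term M n) : M :=
  match t with
  | Var i => v i
  | Par a => a
  | Zero => 0
  | Opp u => - eval v u
  | Add u w => eval v u + eval v w
  end.

Fixpoint sat n (phi : formula M n) : ('I_n -> M) -> Prop :=
  match phi with
  | Eq _ t u => fun v => eval v t = eval v u
  | Lt _ t u => fun v => eval v t < eval v u
  | Not _ psi => fun v => ~ sat psi v
  | And _ psi chi => fun v => sat psi v /\ sat chi v
  | Ex _ psi => fun v => exists x : M, sat psi (scons x v)
  end.

Definition finitely_satisfiable n (p : set (formula M n)) : Prop :=
  forall s : set (formula M n), finite_set s -> s `<=` p ->
    exists v : 'I_n -> M, forall phi, s phi -> sat phi v.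

Definition tp n (c : 'I_n -> M) (D : set M) : set (formula M n) :=
  [set phi | pars_in D phi /\ sat phi c].

Definition global_type n (p : set (formula M n)) : Prop :=
  finitely_satisfiable p /\ forall phi, p phi \/ p (Not phi).

Definition automorphism (s : M -> M) : Prop :=
  [/\ bijective s, zmod_morphism s & {mono s : x y / x < y}].

Definition automorphism_over (A : set M) (s : M -> M) : Prop :=
  automorphism s /\ forall a, A a -> s a = a.

Definition invariant_over (A : set M) n (p : set (formula M n)) : Prop :=
  forall s, automorphism_over A s ->
    forall phi, p (formula_map s phi) <-> p phi.

(* [D #<= K] says |D| < |K|^+, so this is |K|^+-saturation. *)
Definition succ_saturated (K : set M) : Prop :=
  forall D : set M, D #<= K ->
  forall p : set (formula M 1),
    (forall phi, p phi -> pars_in D phi) -> finitely_satisfiable p ->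
    exists x : M, forall phi, p phi -> sat phi (fun=> x).

(* Only the values of [f] on [D] matter. *)
Definition partial_elementary (D : set M) (f : M -> M) : Prop :=
  forall n (phi : formula M n) (d : 'I_n -> M),
    pars_in set0 phi -> (forall i, D (d i)) ->
    (sat phi d <-> sat phi (f \o d)).

(* As above, this is strong |K|^+-homogeneity. *)
Definition strongly_succ_homogeneous (K : set M) : Prop :=
  forall D : set M, D #<= K ->
  forall f : M -> M, partial_elementary D f ->
    exists s, automorphism s /\ forall d, D d -> s d = f d.

(* The equation in [y] says that y is q times x in the unique Q-vector space
   structure of a divisible torsion-free group. *)
Definition Qsubspace (V : set M) : Prop :=
  [/\ V 0, (forall x y, V x -> V y -> V (x + y))
    & forall (q : rat) (x y : M), V x -> y *~ denq q = x *~ numq q -> V y].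

Definition inv_indep (C A B : set M) : Prop :=
  forall n (c : 'I_n -> M), (forall i, C (c i)) ->
    exists p : set (formula M n),
      [/\ global_type p, tp c (A `|` B) `<=` p & invariant_over A p].

Definition cut_indep (C A B : set M) : Prop :=
  forall b1 b2 : M, B b1 -> B b2 -> b1 <= b2 ->
    (exists2 c, C c & b1 <= c <= b2) -> exists2 a, A a & b1 <= a <= b2.

End Semantics.

(* Main.v *)
From Stdlib Require Import ZArith.
From Stdlib Require List.
Require Import Defs.
From mathcomp Require Import all_boot all_order all_algebra.
From mathcomp Require Import boolp classical_sets functions cardinality.
From mathcomp Require Import ssrZ.

Set Implicit Arguments.
Unset Strict Implicit.
Unset Printing Implicit Defensive.

Import Order.TTheory GRing.Theory Num.Theory.
Local Open Scope ring_scope.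

(* A divisible ordered abelian group has quantifier elimination, so a type in n
   variables is given by the signs of the linear terms: a global type extending
   tp(c/AB) is a total cone on M x C that extends the orders of M and B + C, and
   it is invariant over A when each element of C lies at an end of a convex
   subset of M cut out by A. Which end is governed by a total cone K on C with
   K meeting -K in A: an element of K lies below the elements of M in its cut.
   K must contain every c with c <= b for some b in B and no element of A in
   [c, b]; cut-independence says that c and -c are never both of this kind, and
   K is then obtained by Zorn's lemma.
   Conversely, if b1 <= c <= b2 with no element of A in [b1, b2], saturation
   gives y > b2 in the same cut over A, and homogeneity an automorphism over A
   moving b1 to y; an invariant type extending tp(c/AB) would contain both
   y <= x and x <= b2. *)

(** * Order arithmetic in a divisible ordered abelian group *)

Section DoagOrder.
Variables (M : porderZmodType) (HM : is_doag M).
Implicit Types x y z : M.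

Lemma doag_leNgt x y : (x <= y) = ~~ (y < x).
Proof.
apply/idP/idP => [xy|]; first by rewrite lt_leAnge xy andbF.
by case/orP: (doag_total HM x y) => // yx; rewrite lt_leAnge yx /= negbK.
Qed.

Lemma doag_ltNge x y : (x < y) = ~~ (y <= x).
Proof. by rewrite doag_leNgt negbK. Qed.

Lemma doag_subr_ge0 x y : (0 <= y - x) = (x <= y).
Proof.
apply/idP/idP => [/(doag_addr HM x)|/(doag_addr HM (- x))].
  by rewrite add0r subrK.
by rewrite subrr.
Qed.

Lemma doag_subr_gt0 x y : (0 < y - x) = (x < y).
Proof. by rewrite !lt_def subr_eq0 doag_subr_ge0. Qed.

Lemma doag_addr_ge0 x y : 0 <= x -> 0 <= y -> 0 <= x + y.
Proof.
by move=> x0 y0; apply: (le_trans x0); rewrite -doag_subr_ge0 addrC addKr.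
Qed.

Lemma doag_addr_gt0 x y : 0 < x -> 0 <= y -> 0 < x + y.
Proof.
by move=> x0 y0; apply: (lt_le_trans x0); rewrite -doag_subr_ge0 addrC addKr.
Qed.

Lemma doag_mulrn_ge0 x n : 0 <= x -> 0 <= x *+ n.
Proof. by move=> x0; elim: n => // n IH; rewrite mulrS doag_addr_ge0. Qed.

Lemma doag_mulrn_gt0 x n : (0 < n)%N -> 0 < x -> 0 < x *+ n.
Proof.
by case: n => // n _ x0; rewrite mulrS doag_addr_gt0 // doag_mulrn_ge0 // ltW.
Qed.

End DoagOrder.

(** * Fourier-Motzkin elimination in ordered abelian groups *)

Inductive lexp :=
  | LVar of nat
  | LZero
  | LOpp of lexp
  | LAdd of lexp & lexp
  | LMul of lexp & nat.

Fixpoint addv (u v : seq Z) : seq Z :=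
  match u, v with
  | [::], _ => v
  | _, [::] => u
  | a :: u', b :: v' => Z.add a b :: addv u' v'
  end.

Definition scalev (k : Z) (u : seq Z) : seq Z := [seq Z.mul k a | a <- u].

(** Coefficients are binary integers because [lrefute] is run on them by [vm_compute]; missing
    trailing entries count as zero. *)
Fixpoint lcoefs (e : lexp) : seq Z :=
  match e with
  | LVar i => ncons i Z0 [:: Zpos xH]
  | LZero => [::]
  | LOpp e => scalev (Zneg xH) (lcoefs e)
  | LAdd e f => addv (lcoefs e) (lcoefs f)
  | LMul e n => scalev (Z.of_nat n) (lcoefs e)
  end.

(* [(true, u)] stands for [0 < u] and [(false, u)] for [0 <= u]. *)
Definition lconstr : Type := bool * seq Z.

Definition lhead (c : lconstr) : Z := head Z0 c.2.
Definition ltail (c : lconstr) : lconstr := (c.1, behead c.2).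

(** When [c] has a positive and [d] a negative head, both multipliers are positive and the first
    variable cancels. *)
Definition lcombine (c d : lconstr) : lconstr :=
  (c.1 || d.1,
   addv (scalev (Z.opp (lhead d)) (behead c.2)) (scalev (lhead c) (behead d.2))).

Definition lelim (l : seq lconstr) : seq lconstr :=
  let neg := [seq d <- l | Z.ltb (lhead d) Z0] in
  undup ([seq ltail c | c <- l & Z.eqb (lhead c) Z0] ++
    flatten [seq [seq lcombine c d | d <- neg] | c <- l & Z.ltb Z0 (lhead c)]).

(** A strict constraint whose coefficients all vanish reads 0 < 0. *)
Fixpoint lrefute (n : nat) (l : seq lconstr) : bool :=
  has (fun c => c.1 && all (Z.eqb Z0) c.2) l ||
  if n is n'.+1 then lrefute n' (lelim l) else false.

Section LinearSoundness.
Variables (M : porderZmodType) (HM : is_doag M).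
Implicit Types (env : nat -> M) (u v : seq Z) (c d : lconstr).

Fixpoint leval env (e : lexp) : M :=
  match e with
  | LVar i => env i
  | LZero => 0
  | LOpp e => - leval env e
  | LAdd e f => leval env e + leval env f
  | LMul e n => leval env e *+ n
  end.

Fixpoint ldot u env : M :=
  if u is a :: u' then env 0%N *~ int_of_Z a + ldot u' (env \o succn) else 0.

Lemma ldot_add u v env : ldot (addv u v) env = ldot u env + ldot v env.
Proof.
elim: u v env => [|a u IH] [|b v] env /=; rewrite ?add0r ?addr0 //.
by rewrite IH (raddfD int_of_Z) mulrzDr addrACA.
Qed.

Lemma ldot_scale k u env : ldot (scalev k u) env = ldot u env *~ int_of_Z k.
Proof.
elim: u env => [|a u IH] env /=; first by rewrite mul0rz.
by rewrite IH mulrzDl (rmorphM int_of_Z) mulrC mulrzA.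
Qed.

Lemma ldot_coefs e env : ldot (lcoefs e) env = leval env e.
Proof.
elim: e => /= [i||e IH|e IHe f IHf|e IH n].
- elim: i env => [|i IH] env /=; first by rewrite addr0.
  by rewrite mulr0z add0r IH.
- by [].
- by rewrite ldot_scale IH mulrN1z.
- by rewrite ldot_add IHe IHf.
- by rewrite ldot_scale IH (_ : int_of_Z _ = n :> int) // -[RHS]Z_of_intK.
Qed.

Definition lholds env c : bool :=
  if c.1 then 0 < ldot c.2 env else 0 <= ldot c.2 env.

Lemma lholds_tail env c :
  lhead c = Z0 -> lholds env c -> lholds (env \o succn) (ltail c).
Proof.
case: c => s [|a u] //; rewrite /lhead /lholds /= => ->.
by rewrite mulr0z add0r.
Qed.

Lemma int_of_Z_gt0 (z : Z) : Z.lt Z0 z -> exists2 n, (0 < n)%N & int_of_Z z = Posz n.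
Proof.
case: z => // p _; exists (Pos.to_nat p) => //.
by apply/ssrnat.ltP; exact: Pos2Nat.is_pos.
Qed.

Lemma lholds_combine env c d : Z.lt Z0 (lhead c) -> Z.lt (lhead d) Z0 ->
  lholds env c -> lholds env d -> lholds (env \o succn) (lcombine c d).
Proof.
case: c d => [s u] [t v]; rewrite /lhead /= => Hc Hd.
have [m m0 em] := int_of_Z_gt0 Hc.
have Hd' : Z.lt Z0 (Z.opp (head Z0 v)) by apply/Z.opp_pos_neg.
have [n n0 en] := int_of_Z_gt0 Hd'.
rewrite /lholds /lcombine /lhead /=.
(* The full vectors may replace their tails: the heads are m and -n, and their contributions cancel.
   A nonzero head excludes the empty vector. *)
have -> : ldot (addv (scalev (Z.opp (head Z0 v)) (behead u))
    (scalev (head Z0 u) (behead v))) (env \o succn) =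
    ldot u env *+ n + ldot v env *+ m.
  rewrite ldot_add !ldot_scale em en -!pmulrn.
  case: u v {Hc Hd Hd'} em en => [|a u] [|b v] /=;
    try by move=> em; move: m0; rewrite -[m]/(absz (Posz m)) -em.
    by move=> _ en; move: n0; rewrite -[n]/(absz (Posz n)) -en.
  move=> em en; rewrite !mulrnDl em.
  have -> : int_of_Z b = - (Posz n) by rewrite -en (raddfN int_of_Z) opprK.
  rewrite mulrNz -!pmulrn mulNrn -!mulrnA (mulnC n m).
  by rewrite addrACA subrr add0r.
have ge := @ltW _ M 0.
case: s t => [] [] /= hc hd.
- apply: doag_addr_gt0 => //; first exact: doag_mulrn_gt0.
  by apply: doag_mulrn_ge0 => //; exact: ge.
- by apply: doag_addr_gt0 => //; [exact: doag_mulrn_gt0|exact: doag_mulrn_ge0].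
- by rewrite addrC; apply: doag_addr_gt0 => //;
    [exact: doag_mulrn_gt0|exact: doag_mulrn_ge0].
- by apply: doag_addr_ge0 => //; exact: doag_mulrn_ge0.
Qed.

Lemma lholds_elim env l : all (lholds env) l -> all (lholds (env \o succn)) (lelim l).
Proof.
move=> /allP Hl; apply/allP => c; rewrite mem_undup mem_cat => /orP[].
  case/mapP => d; rewrite mem_filter => /andP[/Z.eqb_eq d0 dl] ->.
  exact: lholds_tail (Hl _ dl).
case/flatten_mapP => d; rewrite mem_filter => /andP[/Z.ltb_lt d0 dl].
case/mapP => e; rewrite mem_filter => /andP[/Z.ltb_lt e0 el] ->.
exact: lholds_combine (Hl _ dl) (Hl _ el).
Qed.

Lemma lrefuteP env n l : lrefute n l -> all (lholds env) l -> False.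
Proof.
elim: n l env => [|n IH] l env /= /orP[H|H] Hl //; last exact: IH H (lholds_elim Hl).
all: have /hasP[[s u] cl /andP[/= s1 u0]] := H.
all: have := allP Hl _ cl; rewrite /lholds /= s1.
all: suff -> : forall env', ldot u env' = 0 by rewrite ltxx.
all: elim: u u0 {cl} => //= a u IHu /andP[a0 u0] env'.
all: by case: a a0 => // _; rewrite IHu // mulr0z addr0.
Qed.

Lemma lholds_le env e f :
  leval env e <= leval env f -> lholds env (false, lcoefs (LAdd f (LOpp e))).
Proof. by rewrite /lholds ldot_coefs /= doag_subr_ge0. Qed.

Lemma lholds_lt env e f :
  leval env e < leval env f -> lholds env (true, lcoefs (LAdd f (LOpp e))).
Proof. by rewrite /lholds ldot_coefs /= doag_subr_gt0. Qed.

Lemma doag_le_absurd x y : (y < x -> False) -> x <= y :> M.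
Proof. by move=> H; rewrite doag_leNgt //; apply/negP. Qed.

Lemma doag_lt_absurd x y : (y <= x -> False) -> x < y :> M.
Proof. by move=> H; rewrite doag_ltNge //; apply/negP. Qed.

Lemma doag_eq_absurd x y : (y < x -> False) -> (x < y -> False) -> x = y :> M.
Proof.
move=> Hx Hy; apply/le_anti/andP.
by split; apply: doag_le_absurd.
Qed.

Lemma all_lholds_cons env c l :
  lholds env c -> all (lholds env) l -> all (lholds env) (c :: l).
Proof. by move=> /= -> ->. Qed.

End LinearSoundness.

(** * Reification and the linear arithmetic tactic *)

Ltac latoms_add x l :=
  let rec go k :=
    lazymatch k with
    | [::] => constr:(x :: l)
    | ?y :: ?k' =>
      match goal with
      | _ => let _ := match goal with _ => unify x y end in l
      | _ => go k'
      end
    end in go l.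

Ltac latoms t l :=
  lazymatch t with
  | 0 => l
  | ?a + ?b => let l1 := latoms a l in latoms b l1
  | - ?a => latoms a l
  | ?a *+ ?n => lazymatch isnatcst n with true => latoms a l | _ => latoms_add t l end
  | _ => latoms_add t l
  end
with isnatcst n :=
  lazymatch n with
  | O => constr:(true)
  | S ?m => isnatcst m
  | _ => constr:(false)
  end.

Ltac lindex x l :=
  lazymatch l with
  | ?y :: ?l' =>
    match goal with
    | _ => let _ := match goal with _ => unify x y end in constr:(O)
    | _ => let i := lindex x l' in constr:(S i)
    end
  end.

Ltac lreify t l :=
  lazymatch t with
  | 0 => constr:(LZero)
  | ?a + ?b => let e := lreify a l in let f := lreify b l in constr:(LAdd e f)
  | - ?a => let e := lreify a l in constr:(LOpp e)
  | ?a *+ ?n =>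
    lazymatch isnatcst n with
    | true => let e := lreify a l in constr:(LMul e n)
    | _ => let i := lindex t l in constr:(LVar i)
    end
  | _ => let i := lindex t l in constr:(LVar i)
  end.

Ltac lgoal_atoms G l :=
  lazymatch G with
  | is_true (?x <= ?y) -> ?G' =>
    let l1 := latoms x l in let l2 := latoms y l1 in lgoal_atoms G' l2
  | is_true (?x < ?y) -> ?G' =>
    let l1 := latoms x l in let l2 := latoms y l1 in lgoal_atoms G' l2
  | ?x = ?y -> ?G' =>
    let l1 := latoms x l in let l2 := latoms y l1 in lgoal_atoms G' l2
  | _ => l
  end.

(** [cs] accumulates the constraints and [pf] the proof that they hold; an equation contributes two
    inequalities. One elimination round is allowed per atom. *)
Ltac lloop M HM l cs pf :=
  let le_case x y H cs pf k :=
    let e := lreify x l in let f := lreify y l in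
    k constr:((false, lcoefs (LAdd f (LOpp e))) :: cs)
      constr:(@all_lholds_cons M (fun i => nth 0 l i) _ _
        (@lholds_le M HM (fun i => nth 0 l i) e f H) pf) in
  let lt_case x y H cs pf k :=
    let e := lreify x l in let f := lreify y l in
    k constr:((true, lcoefs (LAdd f (LOpp e))) :: cs)
      constr:(@all_lholds_cons M (fun i => nth 0 l i) _ _
        (@lholds_lt M HM (fun i => nth 0 l i) e f H) pf) in
  lazymatch goal with
  | |- is_true (?x <= ?y) -> _ =>
    let H := fresh in intro H;
    le_case x y H cs pf ltac:(fun cs pf => lloop M HM l cs pf)
  | |- is_true (?x < ?y) -> _ =>
    let H := fresh in intro H;
    lt_case x y H cs pf ltac:(fun cs pf => lloop M HM l cs pf)
  | |- ?x = ?y -> _ =>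
    let H := fresh in let H1 := fresh in let H2 := fresh in intro H;
    assert (H1 : x <= y :> M) by (rewrite H; exact: lexx);
    assert (H2 : y <= x :> M) by (rewrite H; exact: lexx);
    le_case x y H1 cs pf ltac:(fun cs pf =>
      le_case y x H2 cs pf ltac:(fun cs pf => lloop M HM l cs pf))
  | |- False =>
    let n := eval cbv in (size l) in
    refine (@lrefuteP M HM (fun i => nth 0 l i) n cs _ pf);
    vm_compute; reflexivity
  end.

(* Linear arithmetic in M: the hypotheses used are those of the form [x <= y],
   [x < y] and [x = y], and their conjunctions. *)
Ltac doag_lra HM :=
  let M := lazymatch type of HM with is_doag ?M => M end in
  repeat match goal with H : is_true (_ && _) |- _ => case/andP: H; intros end;
  lazymatch goal with
  | |- is_true (_ && _) => apply/andP; split; doag_lra HM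
  | |- is_true (_ <= _) => apply: (doag_le_absurd HM); intro; doag_lra HM
  | |- is_true (_ < _) => apply: (doag_lt_absurd HM); intro; doag_lra HM
  | |- _ = _ => apply: (doag_eq_absurd HM); intro; doag_lra HM
  | |- False =>
    repeat match goal with
    | H : is_true (@Order.le _ _ _ _ : bool) |- _ => revert H
    | H : is_true (@Order.lt _ _ _ _ : bool) |- _ => revert H
    | H : @eq ?T _ _ |- _ => unify T (Num.POrderedZmodule.sort M); revert H
    end;
    lazymatch goal with
    | |- ?G =>
      let l := lgoal_atoms G constr:(@nil M) in
      lloop M HM l constr:(@nil lconstr)
        constr:(erefl true : is_true (all (@lholds M (fun i => nth 0 l i)) [::]))
    end
  end.

(** * Divisible subgroups and cuts *)

(** In a torsion-free divisible group these are the Q-subspaces. The roots themselves come from the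
    ambient group, see [dsub_div]. *)
Record divisible_subgroup (M : zmodType) (V : set M) : Prop := DivSubgroup {
  dsub0 : V 0;
  dsubD : forall x y, V x -> V y -> V (x + y);
  dsubN : forall x, V x -> V (- x);
  dsub_root : forall n x, (0 < n)%N -> V (x *+ n) -> V x }.

Lemma dsubB (M : zmodType) (V : set M) x y :
  divisible_subgroup V -> V x -> V y -> V (x - y).
Proof. by move=> HV Vx Vy; apply: (dsubD HV) => //; apply: (dsubN HV). Qed.

Lemma dsubMn (M : zmodType) (V : set M) x n :
  divisible_subgroup V -> V x -> V (x *+ n).
Proof.
move=> HV Vx; elim: n => [|n IH]; first exact: (dsub0 HV).
by rewrite mulrS; apply: (dsubD HV).
Qed.

(** Opposites are multiples by -1, and n-th roots are multiples by 1/n. *)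
Lemma Qsubspace_divisible (M : porderZmodType) (V : set M) :
  Qsubspace V -> divisible_subgroup V.
Proof.
case=> V0 VD Vq; split=> // [x Vx|n x n0 Vx].
  by apply: (Vq (-1) x) => //; rewrite mulrN1z.
have n0' : (n%:Z != 0 :> int) by rewrite eqz_nat -lt0n.
apply: (Vq (1%:~R / n%:~R) _ _ Vx).
have cop : coprime `|1%Z| `|n%:Z| by rewrite coprime1n.
have en := coprimeq_num cop; have ed := coprimeq_den cop.
by rewrite en ed (negbTE n0') /= gtr0_sg ?ltz_nat // mulr1z.
Qed.

Section Cuts.
Variables (M : porderZmodType) (HM : is_doag M).
Implicit Types x y z a : M.

Lemma doag_lerMn n x y : (0 < n)%N -> (x *+ n <= y *+ n) = (x <= y).
Proof.
move=> n0; apply/idP/idP => [|xy]; last first.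
  by rewrite -(doag_subr_ge0 HM) -mulrnBl (doag_mulrn_ge0 HM) // doag_subr_ge0.
move=> H; rewrite (doag_leNgt HM); apply/negP => yx.
have : 0 < (x - y) *+ n by rewrite (doag_mulrn_gt0 HM) // doag_subr_gt0.
by rewrite mulrnBl doag_subr_gt0 // => /(le_lt_trans H); rewrite ltxx.
Qed.

Lemma doag_ltrMn n x y : (0 < n)%N -> (x *+ n < y *+ n) = (x < y).
Proof. by move=> n0; rewrite !(doag_ltNge HM) doag_lerMn. Qed.

Lemma dsub_div (V : set M) n x : divisible_subgroup V -> (0 < n)%N -> V x ->
  exists2 y, V y & y *+ n = x.
Proof.
move=> HV n0 Vx; have [y yx] := doag_div HM x n0.
by exists y => //; apply: (dsub_root HV n0); rewrite yx.
Qed.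

Variable A : set M.
Hypothesis HA : divisible_subgroup A.

(** For x <= y this says that x and y lie outside A and fill the same cut over A. It is vacuous for
    y < x, so the order is assumed separately where it matters. *)
Definition gap x y := forall a, A a -> x <= a -> a <= y -> False.

Lemma gapMn n x y : (0 < n)%N -> gap x y -> gap (x *+ n) (y *+ n).
Proof.
move=> n0 g a Aa; have [b Ab <-] := dsub_div HA n0 Aa.
by rewrite !doag_lerMn //; exact: g.
Qed.

Lemma gap_sub x y x' y' : gap x y -> x <= x' -> y' <= y -> gap x' y'.
Proof.
by move=> g xx yy a Aa xa ay; apply: (g a) => //; [exact: le_trans xa|exact: le_trans yy].
Qed.

Lemma gapD a x y : A a -> gap x y -> gap (x + a) (y + a).
Proof.
move=> Aa g b Ab xb yb; apply: (g (b - a)); first exact: dsubB.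
- by doag_lra HM.
- by doag_lra HM.
Qed.

Lemma gapN x y : gap x y -> gap (- y) (- x).
Proof.
move=> g b Ab xb yb; apply: (g (- b)); first exact: (dsubN HA).
- by doag_lra HM.
- by doag_lra HM.
Qed.

Lemma gap_trans x y z : gap x y -> gap y z -> gap x z.
Proof.
move=> g h a Aa xa az; case/orP: (doag_total HM a y) => ay.
- exact: g Aa xa ay.
- exact: h Aa ay az.
Qed.

Lemma gapNP x y : ~ gap x y -> exists2 a, A a & x <= a <= y.
Proof.
move=> g; apply: contrapT => h; apply: g => a Aa xa ay; apply: h.
by exists a => //; rewrite xa.
Qed.

(** * Cones compatible with the cuts over A *)

Variable C : set M.
Hypothesis HC : divisible_subgroup C.
Hypothesis sAC : forall a, A a -> C a.

(** K collects the elements whose generic copy sits at the left end of its cut in M. A smaller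
    element of the same cut is then at the left end too, whence [cc_down]; opposites exchange the
    two ends, whence [cc_anti]. *)
Record cut_cone (K : set M) : Prop := CutCone {
  cc_sub : forall z, K z -> C z;
  cc_base : forall a, A a -> K a;
  ccD : forall x y, K x -> K y -> K (x + y);
  cc_root : forall n z, C z -> (0 < n)%N -> K (z *+ n) -> K z;
  cc_anti : forall z, K z -> K (- z) -> A z;
  cc_down : forall y z, C y -> y <= z -> gap y z -> K z -> K y }.

(** * Adjoining an element of C to a cone *)

Section Extension.
Variables (K : set M) (t : M).
Hypotheses (HK : cut_cone K) (Ct : C t) (Kt : ~ K (- t)).

Definition ray w := exists k n, K k /\ w = k + t *+ n.

(** Equality is a separate case because [gap x x] fails for x in A. *)
Definition below x y := x = y \/ x <= y /\ gap x y.

Definition below_ray z := C z /\ exists2 w, ray w & below z w.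

Lemma rayC w : ray w -> C w.
Proof.
move=> [k [n [Kk ->]]]; apply: (dsubD HC); first exact: (cc_sub HK).
exact: dsubMn.
Qed.

Lemma rayD w w' : ray w -> ray w' -> ray (w + w').
Proof.
move=> [k [n [Kk ->]]] [k' [n' [Kk' ->]]]; exists (k + k'), (n + n')%N.
by split; [exact: (ccD HK)|rewrite mulrnDr addrACA].
Qed.

Lemma below_le x y : below x y -> x <= y.
Proof. by case=> [->|[]]. Qed.

Lemma below_gap x y z : ~ A z -> below x z -> below z y -> x <= y /\ gap x y.
Proof.
move=> Az xz zy; split; first exact: le_trans (below_le xz) (below_le zy).
have gxz : gap x z \/ x = z by case: xz => [|[]]; auto.
have gzy : gap z y \/ z = y by case: zy => [|[]]; auto.
case: gxz => [g|->]; case: gzy => [h|<-] //; first exact: gap_trans g h.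
move=> a Aa za az; apply: Az; suff -> : z = a by [].
by apply/le_anti/andP.
Qed.

Lemma ray_neg k n : (0 < n)%N -> K k -> ~ K (- (k + t *+ n)).
Proof.
move=> n0 Kk Kn; apply: Kt; apply: (cc_root HK (dsubN HC Ct) n0).
rewrite (_ : (- t) *+ n = - (k + t *+ n) + k); first exact: (ccD HK).
by rewrite mulNrn opprD addrAC addNr add0r.
Qed.

(** An element of K between -w2 and w1 would put -w2 in K by [cc_down], which [ray_neg] forbids when
    w2 involves t. If w1 or w2 is already in K, [cc_down] applies directly; otherwise such an
    element is built from k1 by a shift in A. *)
Lemma ray_gap w1 w2 : ray w1 -> ray w2 -> - w2 <= w1 -> gap (- w2) w1 -> False.
Proof.
move=> r1 r2 le12 g.
have Cw2 : C (- w2) by apply: (dsubN HC); exact: rayC.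
have Cw1 : C (- w1) by apply: (dsubN HC); exact: rayC.
have g' : gap (- w1) w2 by rewrite -[w2]opprK; exact: gapN.
have le21 : - w1 <= w2 by doag_lra HM.
case: r1 r2 => [k1 [n1 [Kk1 e1]]] [k2 [n2 [Kk2 e2]]].
have [z1|p1] := posnP n1.
  rewrite z1 addr0 in e1.
  have Kw2 : K (- w2) by apply: (cc_down HK Cw2 le12 g); rewrite e1.
  have [z2|p2] := posnP n2; last by apply: (ray_neg p2 Kk2); rewrite -e2.
  rewrite z2 addr0 in e2; apply: (g (- w2)) => //.
  by apply: (dsubN HA); apply: (cc_anti HK) => //; rewrite e2.
have [z2|p2] := posnP n2.
  rewrite z2 addr0 in e2; apply: (ray_neg p1 Kk1); rewrite -e1.
  by apply: (cc_down HK Cw1 le21 g'); rewrite e2.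
set k := k1 + k2; set q := (n1 + n2)%N.
have q0 : (0 < q)%N by rewrite addn_gt0 p1.
have Kk : K k by exact: (ccD HK).
have e12 : w1 + w2 = k + t *+ q by rewrite e1 e2 mulrnDr addrACA.
have Ctq : C (- (t *+ q)) by apply: (dsubN HC); exact: dsubMn.
have le_tk : - (t *+ q) <= k by doag_lra HM.
have [gk|/gapNP[a Aa /andP[ta ak]]] := pselect (gap (- (t *+ q)) k).
  apply: (ray_neg q0 (cc_base HK (dsub0 HA))); rewrite add0r.
  exact: (cc_down HK Ctq le_tk gk).
(* a' is -(n1/q) a, a weighted stand-in for n1 t: from -q t <= a <= k it follows that -w2 <= k1 + a'
   <= w1. *)
have [a' Aa' ea] := dsub_div HA q0 (dsubN HA (dsubMn n1 HA Aa)).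
have Kka : K (k1 + a') by apply: (ccD HK) => //; exact: (cc_base HK).
have tan : (- (t *+ q)) *+ n1 <= a *+ n1 by rewrite doag_lerMn.
have akn : a *+ n1 <= k *+ n1 by rewrite doag_lerMn.
have tkn : (- (t *+ q)) *+ n2 <= k *+ n2 by rewrite doag_lerMn.
have Dq x : x *+ q = x *+ n1 + x *+ n2 by exact: mulrnDr.
have tq n : t *+ n *+ q = t *+ q *+ n by rewrite -!mulrnA mulnC.
rewrite !mulNrn in ea tan tkn; rewrite /k !mulrnDl in akn tkn.
have le1 : - w2 <= k1 + a'.
  rewrite -(@doag_lerMn q) // mulNrn mulrnDl ea e2 mulrnDl tq !Dq.
  by rewrite !Dq in tkn *; doag_lra HM.
have le2 : k1 + a' <= w1.
  by rewrite -(@doag_lerMn q) // mulrnDl ea e1 mulrnDl tq; doag_lra HM.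
have := cc_down HK Cw2 le1 (gap_sub g (lexx _) le2) Kka.
by rewrite e2; exact: ray_neg.
Qed.

Lemma below_ray_anti z : below_ray z -> below_ray (- z) -> A z.
Proof.
move=> [Cz [w1 r1 b1]] [_ [w2 r2 b2]]; apply: contrapT => Az.
have b2' : below (- w2) z.
  case: b2 => [<-|[le g]]; first by left; rewrite opprK.
  by right; split; [doag_lra HM|rewrite -[z]opprK; exact: gapN].
have [le g] := below_gap Az b2' b1.
exact: (ray_gap r1 r2 le g).
Qed.

Lemma below_ray_of_base k : K k -> below_ray k.
Proof.
move=> Kk; split; first exact: (cc_sub HK).
by exists k; [exists k, 0%N; rewrite addr0|left].
Qed.

Lemma below_trans x y z : below x y -> below y z -> below x z.
Proof.
move=> [->//|[l g]] [<-|[l' g']]; right; split=> //; first exact: le_trans l l'.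
exact: gap_trans g g'.
Qed.

(** Translation by y could break the gap only if some a in A had a - y in [x, v]. Then -y would be
    below the ray element v - a, so y would be in A by [below_ray_anti], and a - y would be a point
    of A in the gap. *)
Lemma below_ray_addr x v y :
  ray v -> below x v -> below_ray y -> below (x + y) (v + y).
Proof.
move=> rv [->|[le g]] Ly; [by left|right; split; first by doag_lra HM].
have [Cy _] := Ly.
move=> a Aa l1 l2; apply: (g (a - y)); [|by doag_lra HM|by doag_lra HM].
apply: dsubB => //; apply: below_ray_anti => //; split; first exact: (dsubN HC).
exists (v - a).
  case: rv => [k [n [Kk ->]]]; exists (k - a), n; split; last by rewrite addrAC.
  by apply: (ccD HK) => //; apply: (cc_base HK); exact: (dsubN HA).
right; split; first by doag_lra HM.
have -> : - y = (a - y) + (- a) by doag_lra HM.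
apply: gapD; first exact: (dsubN HA).
by apply: gap_sub g _ (lexx _); doag_lra HM.
Qed.

Lemma below_rayD x y : below_ray x -> below_ray y -> below_ray (x + y).
Proof.
move=> Lx Ly; have [Cx [v rv xv]] := Lx; have [Cy [w rw yw]] := Ly.
split; first exact: (dsubD HC).
exists (v + w); first exact: rayD.
apply: (below_trans (below_ray_addr rv xv Ly)).
rewrite addrC [v + w]addrC; apply: below_ray_addr => //.
by split; [exact: rayC|exists v => //; left].
Qed.

Lemma below_rayMn x n : below_ray x -> below_ray (x *+ n).
Proof.
move=> Lx; elim: n => [|n IH]; last by rewrite mulrS; apply: below_rayD.
by apply: below_ray_of_base; apply: (cc_base HK); exact: (dsub0 HA).
Qed.

(** Rays use only natural multiples of t; passing to roots restores [cc_root]. *)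
Definition cone_ext z := C z /\ exists2 m, (0 < m)%N & below_ray (z *+ m).

Lemma cone_ext_cone : cut_cone cone_ext.
Proof.
split.
- by move=> z [].
- move=> a Aa; split; first exact: sAC.
  by exists 1%N => //; apply: below_ray_of_base; exact: (cc_base HK).
- move=> x y [Cx [m m0 Lx]] [Cy [n n0 Ly]]; split; first exact: (dsubD HC).
  exists (m * n)%N; first by rewrite muln_gt0 m0.
  rewrite mulrnDl mulrnA [(m * n)%N]mulnC mulrnA.
  by apply: below_rayD; exact: below_rayMn.
- move=> n z Cz n0 [_ [m m0 Lz]]; split=> //; exists (n * m)%N.
    by rewrite muln_gt0 n0.
  by rewrite mulrnA.
- move=> z [Cz [m m0 Lz]] [_ [n n0 Ln]].
  have mn0 : (0 < m * n)%N by rewrite muln_gt0 m0.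
  apply: (dsub_root HA mn0); apply: below_ray_anti.
    by rewrite mulrnA; exact: below_rayMn.
  by rewrite -mulNrn mulnC mulrnA; exact: below_rayMn.
- move=> y z Cy yz g [Cz [m m0 [Czm [w rw zw]]]]; split=> //; exists m => //.
  split; first exact: dsubMn.
  exists w => //; apply: below_trans zw; right; split; last exact: gapMn.
  by rewrite doag_lerMn.
Qed.

Lemma sub_cone_ext z : K z -> cone_ext z.
Proof.
move=> Kz; split; first exact: (cc_sub HK).
by exists 1%N => //; exact: below_ray_of_base.
Qed.

Lemma cone_ext_gen : cone_ext t.
Proof.
split=> //; exists 1%N => //; split; first exact: dsubMn.
exists t; last by left.
exists 0, 1%N; rewrite add0r; split=> //; apply: (cc_base HK); exact: (dsub0 HA).
Qed.

End Extension.
(** * Total cones bounding C from above by B *)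

Variable B : set M.
Hypothesis HB : divisible_subgroup B.
Hypothesis sAB : forall a, A a -> B a.
Hypothesis Hcut : forall b1 b2 c, B b1 -> B b2 -> C c -> b1 <= c -> c <= b2 ->
  ~ gap b1 b2.

Lemma gap_join x y y' z : gap x y -> gap y' z -> y' <= y -> gap x z.
Proof.
move=> g h yy a Aa xa az; case/orP: (doag_total HM a y) => ay.
- exact: g Aa xa ay.
- by apply: h Aa _ az; exact: le_trans ay.
Qed.

Lemma gapMn_inv n x y : (0 < n)%N -> gap (x *+ n) (y *+ n) -> gap x y.
Proof.
move=> n0 g a Aa xa ay; apply: (g (a *+ n)); rewrite ?doag_lerMn //.
exact: dsubMn.
Qed.

Definition forced z := C z /\ exists2 b, B b & z <= b /\ gap z b.

(** Otherwise z would lie between two elements -b' and b of B with no point of A between them,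
    against [Hcut]. *)
Lemma forced_anti z : forced z -> forced (- z) -> False.
Proof.
move=> [Cz [b Bb [zb g]]] [_ [b' Bb' [zb' g']]].
have le1 : - b' <= z by doag_lra HM.
apply: (Hcut (dsubN HB Bb') Bb Cz le1 zb); apply: gap_trans g.
by rewrite -[z]opprK; exact: gapN.
Qed.

Lemma forced_down y z : C y -> y <= z -> gap y z -> forced z -> forced y.
Proof.
move=> Cy yz g [Cz [b Bb [zb gb]]]; split=> //; exists b => //; split.
  exact: le_trans zb.
exact: gap_trans gb.
Qed.

Lemma forcedDbase z a : A a -> forced z -> forced (z + a).
Proof.
move=> Aa [Cz [b Bb [zb g]]]; split; first by apply: (dsubD HC) => //; exact: sAC.
exists (b + a); first by apply: (dsubD HB) => //; exact: sAB.
by split; [doag_lra HM|exact: gapD].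
Qed.

Lemma forcedMn n z : (0 < n)%N -> forced z -> forced (z *+ n).
Proof.
move=> n0 [Cz [b Bb [zb g]]]; split; first exact: dsubMn.
exists (b *+ n); first exact: dsubMn.
by split; [rewrite doag_lerMn|exact: gapMn].
Qed.

Lemma forced_root n z : C z -> (0 < n)%N -> forced (z *+ n) -> forced z.
Proof.
move=> Cz n0 [_ [b Bb [zb g]]]; split=> //.
have [b' Bb' eb] := dsub_div HB n0 Bb.
exists b' => //; move: zb g; rewrite -eb doag_lerMn // => zb g.
by split=> //; exact: gapMn_inv g.
Qed.

(* Such an e lies in a cut over A that is stable under doubling. Two forced
   elements may add up to a - e, so the opposites of all of these are put in
   the cone. *)
Definition unforced e := [/\ C e, 0 < e, gap e (e *+ 2) & ~ forced e].

Definition base_cone z :=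
  [\/ A z, forced z | exists a e, [/\ A a, unforced e & z = a - e]].

Lemma forced_reflect x y b a : C x -> B b -> A a -> x <= a - y -> a - y <= b ->
  gap x b -> C y -> forced (- y).
Proof.
move=> Cx Bb Aa l1 l2 g Cy; split; first exact: (dsubN HC).
exists (b - a); first by apply: dsubB => //; exact: sAB.
split; first by doag_lra HM.
have -> : - y = (a - y) + (- a) by doag_lra HM.
apply: gapD; first exact: (dsubN HA).
exact: gap_sub g l1 (lexx _).
Qed.

(** [Hcut] yields a point of A in [b - d, b], and the gap leaves it no room except to the left of
    x. *)
Lemma cut_left x b d : B b -> B d -> C x -> x <= b -> gap x b -> b - d <= x ->
  exists2 a, A a & b - d <= a < x.
Proof.
move=> Bb Bd Cx xb g dx.
have /gapNP[a Aa /andP[l1 l2]] := Hcut (dsubB HB Bb Bd) Bb Cx dx xb.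
exists a => //; rewrite l1 /= (doag_ltNge HM); apply/negP => xa.
exact: g Aa xa l2.
Qed.

Lemma forced_defect x y b b' a : C x -> C y -> B b -> B b' -> A a ->
  x <= b -> gap x b -> y <= b' -> gap y b' -> b + b' = a -> 0 < a - x - y ->
  unforced (a - x - y).
Proof.
move=> Cx Cy Bb Bb' Aa xb g yb g' ea e0; set e := a - x - y.
have Ce : C e by apply: dsubB => //; apply: dsubB => //; exact: sAC.
split=> //.
- move=> h Ah l1 l2.
  have [h2 Ah2 eh] := @dsub_div A 2 h HA isT Ah.
  have [|a0 Aa0 /andP[l3 l4]] := cut_left Bb (sAB Ah) Cx xb g.
    by rewrite /e in l1; doag_lra HM.
  have gg : gap x (a - y).
    apply: gap_trans g _.
    have -> : b = - b' + a by doag_lra HM.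
    by rewrite addrC; rewrite [a - y]addrC [a + _]addrC; apply: gapD => //; exact: gapN.
  have nin z : A z -> x <= z -> a - y < z.
    by move=> Az xz; rewrite (doag_ltNge HM); apply/negP; exact: gg.
  have l5 : a - y < a0 + h.
    by apply: nin; [exact: (dsubD HA)|doag_lra HM].
  rewrite /e in l1 l2.
  (* a0 is left of the cut and a0 + h right of it. On whichever side the midpoint a0 + h/2 falls,
     [x, a - y] fits in a length below h/2, so 2e < h. *)
  have [l6|l6] := orP (doag_total HM x (a0 + h2)).
    have l7 := nin _ (dsubD HA Aa0 Ah2) l6.
    by doag_lra HM.
  by doag_lra HM.
- move=> [_ [d Bd [ed gd]]]; rewrite /e in ed.
  have [|a1 Aa1 /andP[l1 l1']] := cut_left Bb Bd Cx xb g; first by doag_lra HM.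
  have [|a2 Aa2 /andP[l2 l2']] := cut_left Bb' Bd Cy yb g'; first by doag_lra HM.
  (* h is the mean of b - a1 and b' - a2, hence at most d. It is at most the larger of the two, so
     the corresponding a2 + h or a1 + h stays left of y or x, which gives e < h. *)
  have [h Ah eh] := @dsub_div A 2 _ HA isT (dsubB HA (dsubB HA Aa Aa1) Aa2).
  apply: (gd h) => //; last by doag_lra HM.
  have [le|le] := orP (doag_total HM (b - a1) (b' - a2)).
    have : a2 + h < y.
      rewrite (doag_ltNge HM); apply/negP => l3.
      by apply: (g' (a2 + h)) => //; [exact: (dsubD HA)|doag_lra HM].
    by rewrite /e => ?; doag_lra HM.
  have : a1 + h < x.
    rewrite (doag_ltNge HM); apply/negP => l3.
    by apply: (g (a1 + h)) => //; [exact: (dsubD HA)|doag_lra HM].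
  by rewrite /e => ?; doag_lra HM.
Qed.

Lemma forcedD x y : forced x -> forced y -> base_cone (x + y).
Proof.
move=> Fx Fy; have [Cx [b Bb [xb g]]] := Fx; have [Cy [b' Bb' [yb g']]] := Fy.
have [h|/gapNP[a Aa /andP[l1 l2]]] := pselect (gap (x + y) (b + b')).
  apply: Or32; split; first exact: (dsubD HC).
  by exists (b + b'); [exact: (dsubD HB)|split=> //; doag_lra HM].
have l3 : x + b' < a.
  rewrite (doag_ltNge HM); apply/negP => l3; apply: (forced_anti Fx).
  by apply: (forced_reflect Cy Bb' Aa _ _ g') => //; doag_lra HM.
have l4 : b + y < a.
  rewrite (doag_ltNge HM); apply/negP => l4; apply: (forced_anti Fy).
  by apply: (forced_reflect Cx Bb Aa _ _ g) => //; doag_lra HM.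
(* Since y < a - b <= b', the element a - b bounds y in place of b', and b + (a - b) is in A as
   [forced_defect] requires. *)
apply: Or33; exists a, (a - x - y); split=> //; last by doag_lra HM.
apply: (@forced_defect x y b (a - b)) => //.
- by apply: dsubB => //; exact: sAB.
- by doag_lra HM.
- by apply: gap_sub g' (lexx _) _; doag_lra HM.
- by doag_lra HM.
- by doag_lra HM.
Qed.

(** If a in A separates x - e from b, then x - e = a - f with f = e - (x - a). Here 2 (b - a) < e,
    since otherwise e would be forced; so f > e/2 remains in the cut of e, which is stable under
    doubling. *)
Lemma forcedD_unforced x e : forced x -> unforced e -> base_cone (x - e).
Proof.
move=> Fx [Ce e0 ge nFe]; have [Cx [b Bb [xb g]]] := Fx.
have [h|/gapNP[a Aa /andP[l1 l2]]] := pselect (gap (x - e) b).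
  apply: Or32; split; first exact: dsubB.
  by exists b => //; split=> //; doag_lra HM.
have l3 : a < x by rewrite (doag_ltNge HM); apply/negP => l3; exact: g Aa l3 l2.
have gs : gap (x - a) (b - a) by apply: gapD => //; exact: (dsubN HA).
have g2 : gap ((x - a) *+ 2) ((b - a) *+ 2) by exact: gapMn.
have extend d : B d -> e <= d *+ 2 -> forall f, f <= e -> gap (f *+ 2) (d *+ 2) -> False.
  move=> Bd ed f fe gf; apply: nFe; split=> //; exists (d *+ 2); first exact: dsubMn.
  by split=> //; apply: gap_join ge gf _; rewrite doag_lerMn.
have Bba : B (b - a) by apply: dsubB => //; exact: sAB.
have l4 : (b - a) *+ 2 < e.
  rewrite (doag_ltNge HM); apply/negP => l4.
  by apply: (extend (b - a) Bba l4 (x - a)) => //; doag_lra HM.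
apply: Or33; exists a, (e - (x - a)); split=> //; last by doag_lra HM.
set f := e - (x - a); have l5 : e < f *+ 2 by rewrite /f; doag_lra HM.
have l6 : f < e by rewrite /f; doag_lra HM.
split.
- by apply: dsubB => //; apply: dsubB => //; exact: sAC.
- by doag_lra HM.
- apply: (@gap_join f e e).
  + apply: (@gapMn_inv 2) => //; apply: gap_sub ge _ (lexx _); exact: ltW.
  + by apply: gap_sub ge (lexx _) _; doag_lra HM.
  + exact: lexx.
- move=> [_ [d Bd [fd gd]]]; apply: (extend d Bd _ f);
    [by doag_lra HM|exact: ltW|exact: gapMn].
Qed.

(** With e <= f, the sum lies in [f, 2f], inside the cut of f. *)
Lemma unforcedD e f : unforced e -> unforced f -> unforced (e + f).
Proof.
wlog ef : e f / e <= f => [H He Hf|].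
  have [l|l] := orP (doag_total HM e f); first exact: H.
  by rewrite addrC; exact: H.
move=> [Ce e0 ge nFe] [Cf f0 gf nFf].
have gf4 : gap (f *+ 2) ((f *+ 2) *+ 2) by exact: gapMn.
have gf' : gap f ((f *+ 2) *+ 2) by exact: gap_trans gf4.
split.
- exact: (dsubD HC).
- by doag_lra HM.
- by apply: gap_sub gf' _ _; doag_lra HM.
- move=> h; apply: nFf; apply: forced_down h => //; first by doag_lra HM.
  by apply: gap_sub gf (lexx _) _; doag_lra HM.
Qed.

Lemma base_coneDbase a z : A a -> base_cone z -> base_cone (a + z).
Proof.
move=> Aa [Az|Fz|[a' [e [Aa' He ->]]]].
- by apply: Or31; exact: (dsubD HA).
- by apply: Or32; rewrite addrC; exact: forcedDbase.
- by apply: Or33; exists (a + a'), e; rewrite addrA; split=> //; exact: (dsubD HA).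
Qed.

Lemma base_coneP : cut_cone base_cone.
Proof.
split.
- move=> z [Az|[]//|[a [e [Aa [Ce _ _ _] ->]]]]; first exact: sAC.
  by apply: dsubB => //; exact: sAC.
- by move=> a; exact: Or31.
- move=> x y [Ax Hy|Fx|[a [e [Aa He ->]]]]; first exact: base_coneDbase.
    case=> [Ay|Fy|[a [e [Aa He ->]]]].
    + by rewrite addrC; apply: base_coneDbase => //; exact: Or32.
    + exact: forcedD.
    + by rewrite addrCA; apply: base_coneDbase => //; exact: forcedD_unforced.
  rewrite -addrA => Hy; apply: base_coneDbase => //.
  case: Hy => [Ay|Fy|[a' [e' [Aa' He' ->]]]].
  + by apply: Or33; exists y, e; rewrite addrC.
  + by rewrite addrC; exact: forcedD_unforced.
  + apply: Or33; exists a', (e + e'); split=> //; first exact: unforcedD.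
    by doag_lra HM.
- move=> n z Cz n0 [Az|Fz|[a [e [Aa [Ce e0 ge nFe] ez]]]].
  + by apply: Or31; exact: (dsub_root HA n0).
  + by apply: Or32; exact: forced_root Fz.
  have [a' Aa' ea] := dsub_div HA n0 Aa.
  have ee : e = (a' - z) *+ n by rewrite mulrnBl ea ez; doag_lra HM.
  apply: Or33; exists a', (a' - z); split=> //; last by doag_lra HM.
  split.
  + by apply: dsubB => //; exact: sAC.
  + by rewrite -(@doag_ltrMn n) // -ee mul0rn.
  + by apply: (gapMn_inv n0); rewrite -mulrnA mulnC mulrnA -ee.
  + by move/(forcedMn n0); rewrite -ee.
(* For [cc_anti]: if z is forced and -z = a - e, then e = z + a is forced. Two unforced elements e
   <= f cannot sum to a point of A, which would lie in [f, 2f]. *)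
- have FP z a e : A a -> unforced e -> forced z -> - z = a - e -> False.
    move=> Aa [_ _ _ nFe] Fz ez; apply: nFe.
    by have := forcedDbase Aa Fz; rewrite (_ : z + a = e) //; doag_lra HM.
  have PP e f a : unforced e -> unforced f -> A a -> e <= f -> e + f = a -> False.
    by move=> [_ e0 _ _] [_ _ gf _] Aa ef ea; apply: (gf a) => //; doag_lra HM.
  move=> z [//|Fz|[a [e [Aa He ez]]]] [/(dsubN HA)|Fz'|[a' [f [Aa' Hf ez']]]];
    rewrite ?opprK //.
  + by case: (forced_anti Fz Fz').
  + by case: (FP _ _ _ Aa' Hf Fz ez').
  + by case: (FP _ _ _ Aa He Fz'); rewrite opprK.
  + exfalso; have Aaa := dsubD HA Aa Aa'.
    have [l|l] := orP (doag_total HM e f).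
      by apply: (PP _ _ _ He Hf Aaa l); doag_lra HM.
    by apply: (PP _ _ _ Hf He Aaa l); doag_lra HM.
- move=> y z Cy yz g [Az|Fz|[a [e [Aa [Ce e0 ge nFe] ez]]]].
  + by case: (g z).
  + by apply: Or32; exact: forced_down Fz.
  apply: Or33; exists a, (a - y); split=> //; last by doag_lra HM.
  have gee : gap e (a - y).
    have -> : e = - z + a by doag_lra HM.
    by rewrite addrC [a - y]addrC [a - z]addrC; apply: gapD => //; exact: gapN.
  have le : e <= a - y by doag_lra HM.
  split.
  + by apply: dsubB => //; exact: sAC.
  + by doag_lra HM.
  + apply: (gap_sub (x := e) (y := (a - y) *+ 2)) => //; apply: (gap_join ge).
      by apply: (gapMn (n := 2)) gee.
    exact: lexx.
  + by move=> h; apply: nFe; exact: forced_down h.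
Qed.

(** A maximal cone containing [base_cone] is total: if it missed z and -z, [cone_ext] would adjoin
    z. *)
Lemma total_cut_cone : exists K, [/\ cut_cone K, (forall z, forced z -> K z)
  & forall z, C z -> K z \/ K (- z)].
Proof.
(* X need only be a cone after union with [base_cone], so the empty chain also has an admissible
   union. *)
have [|K [HK Kmax]] := @Zorn_bigcup M
  [set X | cut_cone (fun z => base_cone z \/ X z)].
  move=> F sF Ftot.
  pose U z := base_cone z \/ (\bigcup_(X in F) X)%classic z.
  have UX z z' : U z -> U z' -> exists X, [/\ cut_cone X, X z, X z' &
      forall w, X w -> U w].
    move=> Uz Uz'.
    have up X : F X -> forall w, base_cone w \/ X w -> U w.
      by move=> FX w [h|h]; [left|right; exists X].
    case: Uz Uz' => [bz|[X FX Xz]] [bz'|[X' FX' Xz']].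
    + by exists base_cone; split=> //; [exact: base_coneP|left].
    + exists (fun z => base_cone z \/ X' z); split;
        [exact: sF|by left|by right|exact: up].
    + exists (fun z => base_cone z \/ X z); split;
        [exact: sF|by right|by left|exact: up].
    + have [XX|XX] := Ftot _ _ FX FX'.
        exists (fun z => base_cone z \/ X' z); split;
        [exact: sF|right; exact: XX|by right|exact: up].
      exists (fun z => base_cone z \/ X z); split;
        [exact: sF|by right|right; exact: XX|exact: up].
  have U1 z : U z -> exists X, [/\ cut_cone X, X z & forall w, X w -> U w].
    by move=> Uz; have [X [? ? _ ?]] := UX z z Uz Uz; exists X.
  split.
  + by move=> z /U1[X [HX Xz _]]; exact: (cc_sub HX).
  + by move=> a Aa; left; exact: Or31.
  + move=> x y Ux Uy; have [X [HX Xx Xy up]] := UX _ _ Ux Uy.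
    by apply: up; exact: (ccD HX).
  + move=> n z Cz n0 /U1[X [HX Xz up]]; apply: up; exact: (cc_root HX Cz n0).
  + by move=> z Uz Uz'; have [X [HX Xx Xy up]] := UX _ _ Uz Uz'; exact: (cc_anti HX).
  + move=> y z Cy yz g /U1[X [HX Xz up]]; apply: up; exact: (cc_down HX Cy yz g).
exists (fun z => base_cone z \/ K z); split=> //.
  by move=> z Fz; left; exact: Or32.
move=> z Cz; apply: contrapT => nK.
have nKz : ~ (base_cone (- z) \/ K (- z)) by move=> h; apply: nK; right.
pose K' := cone_ext (fun z => base_cone z \/ K z) z.
have K'P : cut_cone K' by exact: cone_ext_cone.
have sub w : base_cone w \/ K w -> K' w by exact: sub_cone_ext.
apply: (Kmax K'); last first.
  rewrite /= (_ : (fun _ => _) = K') //; apply/funext => w; apply/propext.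
  by split=> [[h|//]|]; [apply: sub; left|right].
split; first by move=> w Kw; apply: sub; right.
move=> h; apply: nK; left; right; apply: h; exact: cone_ext_gen.
Qed.

End Cuts.

(** * Divisible groups preordered by a total cone *)

(** x is below y when y - x is in P. This is only a preorder: in the amalgam, (a, a) with a in A is
    equivalent to 0. The domain D is a subset so that M x C can be handled inside M x M. *)
Record total_cone (S : zmodType) (D P : set S) : Prop := TotalCone {
  tc_dom : divisible_subgroup D;
  tc_div : forall n x, (0 < n)%N -> D x -> exists2 y, D y & y *+ n = x;
  tc0 : P 0;
  tcD : forall x y, D x -> D y -> P x -> P y -> P (x + y);
  tc_total : forall x, D x -> P x \/ P (- x);
  tc_nontriv : exists2 x, D x & ~ P x }.

Section TotalCone.
Variables (S : zmodType) (D P : set S).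
Hypothesis H : total_cone D P.
Let HD := tc_dom H.

Lemma tc_trans x y z : D x -> D y -> D z -> P (y - x) -> P (z - y) -> P (z - x).
Proof.
move=> Dx Dy Dz xy yz; rewrite -(subrKA y); rewrite (addrC z).
have -> : - y + z + (y - x) = (z - y) + (y - x) by rewrite (addrC z).
by apply: (tcD H) => //; exact: dsubB.
Qed.

(** For the converse, if -x is in P, then x is the sum of (n+1) x and n (-x). *)
Lemma tcMn x n : (0 < n)%N -> D x -> P (x *+ n) <-> P x.
Proof.
have up z m : D z -> P z -> P (z *+ m).
  move=> Dz Pz; elim: m => [|m IH]; first exact: (tc0 H).
  by rewrite mulrS; apply: (tcD H) => //; exact: dsubMn.
move=> n0 Dx; split; last exact: up.
case: n n0 => // n _ Pn; have [//|PN] := tc_total H Dx.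
have -> : x = x *+ n.+1 + (- x) *+ n by rewrite mulrS mulNrn addrK.
apply: (tcD H) => //; [exact: dsubMn|exact: dsubMn (dsubN HD Dx)|].
exact: up (dsubN HD Dx) PN.
Qed.

End TotalCone.

Lemma list_max (T : Type) (Q : T -> Prop) (R : T -> T -> Prop) (l : seq T) :
  (forall p q, List.In p l -> List.In q l -> R p q \/ R q p) ->
  (forall p q r, List.In p l -> List.In q l -> List.In r l -> R p q -> R q r -> R p r) ->
  (forall p, List.In p l -> ~ Q p) \/
  exists m, [/\ List.In m l, Q m & forall p, List.In p l -> Q p -> R p m].
Proof.
elim: l => [|a l IH] tot tr; first by left.
have [||nQ|[m [ml Qm mmax]]] := IH.
- by move=> p q pl ql; apply: tot; right.
- by move=> p q r pl ql rl; apply: tr; right.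
- have [Qa|nQa] := pselect (Q a); last by left=> p [<-|/nQ].
  right; exists a; split=> //; first by left.
  by move=> p [<- _|/nQ//]; have [] := tot a a (or_introl erefl) (or_introl erefl).
- have tota := tot a _ (or_introl erefl) (or_intror ml).
  have maa : R a a by have [] := tot a a (or_introl erefl) (or_introl erefl).
  right; have [[Qa ma]|nQa] := pselect (Q a /\ R m a).
    exists a; split=> //; first by left.
    move=> p [<- //|pl Qp]; apply: (tr _ m) (mmax _ pl Qp) ma;
      [by right|by right|by left].
  exists m; split=> //; first by right.
  move=> p [<- Qa|]; last exact: mmax.
  by case: tota => // ma; case: nQa.
Qed.

(** * Back-and-forth between dense total preorders *)

Section BackAndForth.
Variables (S S' : zmodType) (D P : set S) (D' P' : set S').
Hypotheses (H : total_cone D P) (H' : total_cone D' P').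
Implicit Types l : seq (S * S').

Definition same_sign s s' := (P s <-> P' s') /\ (P (- s) <-> P' (- s')).

Lemma same_signN s s' : same_sign s s' -> same_sign (- s) (- s').
Proof. by rewrite /same_sign !opprK; tauto. Qed.

Definition order_iso l := forall p q, List.In p l -> List.In q l ->
  [/\ D p.1, D' p.2 & P (q.1 - p.1) <-> P' (q.2 - p.2)].

(** x is sent to the image of a point equivalent to it, or beyond an extreme image, or to the
    midpoint of the images of its two neighbours. *)
Lemma order_iso_extend l x : order_iso l -> D x ->
  exists2 x', D' x' & forall p, List.In p l -> same_sign (x - p.1) (x' - p.2).
Proof.
move=> iso Dx; have HD := tc_dom H; have HD' := tc_dom H'.
have Dl p : List.In p l -> D p.1 by move=> pl; case: (iso p p pl pl).
have Dl' p : List.In p l -> D' p.2 by move=> pl; case: (iso p p pl pl).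
have isoP p q : List.In p l -> List.In q l -> P (q.1 - p.1) <-> P' (q.2 - p.2).
  by move=> pl ql; case: (iso p q pl ql).
have tot p q : List.In p l -> List.In q l -> P (q.1 - p.1) \/ P (p.1 - q.1).
  move=> /Dl Dp /Dl Dq; have := tc_total H (dsubB HD Dq Dp); by rewrite opprB.
have totx p : List.In p l -> P (x - p.1) \/ P (p.1 - x).
  move=> /Dl Dp; have := tc_total H (dsubB HD Dx Dp); by rewrite opprB.
have signE p x' : (P (x - p.1) <-> P' (x' - p.2)) ->
    (P (p.1 - x) <-> P' (p.2 - x')) -> same_sign (x - p.1) (x' - p.2).
  by rewrite /same_sign !opprB.
have atm m : List.In m l -> P (x - m.1) -> P (m.1 - x) -> exists2 x', D' x' &
    forall p, List.In p l -> same_sign (x - p.1) (x' - p.2).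
  move=> ml xm mx; have Dm := Dl _ ml; exists m.2; first exact: Dl'.
  move=> p pl; have Dp := Dl _ pl; apply: signE.
    by rewrite -isoP //; split=> h;
      [exact: (tc_trans H Dp Dx Dm h mx)|exact: (tc_trans H Dp Dm Dx h xm)].
  by rewrite -isoP //; split=> h;
    [exact: (tc_trans H Dm Dx Dp xm h)|exact: (tc_trans H Dx Dm Dp mx h)].
have [||nlo|[m [ml xm mmax]]] :=
  @list_max _ (fun p => P (x - p.1)) (fun p q => P (q.1 - p.1)) l.
- by move=> p q pl ql; exact: tot.
- by move=> p q r /Dl Dp /Dl Dq /Dl Dr pq qr; exact: (tc_trans H Dp Dq Dr).
all: have [||nhi|[h [hl hx hmin]]] :=
  @list_max _ (fun p => P (p.1 - x)) (fun p q => P (p.1 - q.1)) l.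
all: try by move=> p q pl ql; have := tot p q pl ql; tauto.
all: try by move=> p q r /Dl Dp /Dl Dq /Dl Dr pq qr; exact: (tc_trans H Dr Dq Dp).
- exists 0; first exact: (dsub0 HD').
  by move=> p pl; have := totx p pl; have := nlo p pl; have := nhi p pl; tauto.
(* x is below all of l. Being outside P', e is strictly negative and moves past the least image. *)
- have [e De nPe] := tc_nontriv H'.
  have Pe : P' (- e) by case: (tc_total H' De).
  have Dh := Dl' _ hl.
  exists (h.2 + e); first exact: (dsubD HD').
  move=> p pl; have Dp := Dl' _ pl.
  have px : P (p.1 - x) by have := totx p pl; have := nlo p pl; tauto.
  have hp : P' (p.2 - h.2) by rewrite -isoP //; exact: hmin.
  apply: signE; split=> //; first by have := nlo p pl; tauto.
    move=> xp; case: nPe.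
    have -> : e = (h.2 + e) - h.2 by rewrite addrC addrA addNr add0r.
    by apply: (tc_trans H' Dh Dp _ hp xp); exact: (dsubD HD').
  move=> _; apply: (tc_trans H' _ Dh Dp _ hp); first exact: (dsubD HD').
  by rewrite opprD addrA subrr add0r.
- have [e De nPe] := tc_nontriv H'.
  have Pe : P' (- e) by case: (tc_total H' De).
  have Dm := Dl' _ ml.
  exists (m.2 - e); first exact: dsubB.
  move=> p pl; have Dp := Dl' _ pl.
  have px : P (x - p.1) by have := totx p pl; have := nhi p pl; tauto.
  have mp : P' (m.2 - p.2) by rewrite -isoP //; exact: mmax.
  have Dme : D' (m.2 - e) by exact: dsubB.
  apply: signE; split=> //; [|by have := nhi p pl; tauto|].
    move=> _; apply: (tc_trans H' Dp Dm Dme mp).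
    by rewrite addrC addrA addNr add0r.
  move=> xp; case: nPe.
  have -> : e = m.2 - (m.2 - e) by rewrite opprB addrC subrK.
  exact: (tc_trans H' Dme Dp Dm xp mp).
- have [mx|nmx] := pselect (P (m.1 - x)); first exact: atm ml xm mx.
  have [xh|nxh] := pselect (P (x - h.1)); first exact: atm hl xh hx.
  have Dm := Dl' _ ml; have Dh := Dl' _ hl.
  have [x' Dx' ex] := @tc_div _ _ _ H' 2 _ isT (dsubD HD' Dm Dh).
  have nmh : ~ P' (m.2 - h.2).
    rewrite -isoP // => mh; apply: nmx.
    exact: (tc_trans H Dx (Dl _ hl) (Dl _ ml) hx mh).
  have hm : P' (h.2 - m.2).
    rewrite -isoP //; exact: (tc_trans H (Dl _ ml) Dx (Dl _ hl) xm hx).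
  have em : (x' - m.2) *+ 2 = h.2 - m.2.
    by rewrite mulrnBl ex mulr2n (addrC m.2 h.2) addrKA.
  have eh : (x' - h.2) *+ 2 = m.2 - h.2.
    by rewrite mulrnBl ex mulr2n addrKA.
  have mx' : P' (x' - m.2).
    by apply/(tcMn H' (n := 2)) => //; [exact: dsubB|rewrite em].
  have xh' : P' (h.2 - x').
    apply/(tcMn H' (n := 2)) => //; first exact: dsubB.
    by rewrite -opprB mulNrn eh opprB.
  have nmx' : ~ P' (m.2 - x').
    move/(tcMn H' (n := 2) isT (dsubB HD' Dm Dx')).
    by rewrite -opprB mulNrn em opprB.
  have nxh' : ~ P' (x' - h.2).
    by move/(tcMn H' (n := 2) isT (dsubB HD' Dx' Dh)); rewrite eh.
  exists x' => // p pl; have Dp := Dl' _ pl; have Dp1 := Dl _ pl.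
  have [xp|px] := totx p pl.
    have mp : P' (m.2 - p.2) by rewrite -isoP //; exact: mmax.
    apply: signE; split=> //.
    + by move=> _; exact: (tc_trans H' Dp Dm Dx').
    + move=> px; case: nmx; apply: (tc_trans H Dx Dp1 (Dl _ ml) px).
      exact: mmax.
    + by move=> px; case: nmx'; exact: (tc_trans H' Dx' Dp Dm px).
  have hp : P' (p.2 - h.2) by rewrite -isoP //; exact: hmin.
  apply: signE; split=> //.
  + by move=> xp; case: nxh; apply: (tc_trans H (Dl _ hl) Dp1 Dx _ xp); exact: hmin.
  + by move=> xp; case: nxh'; exact: (tc_trans H' Dh Dp Dx').
  + by move=> _; exact: (tc_trans H' Dx' Dh Dp).
Qed.

End BackAndForth.

(** * Elimination of a variable *)

Section Elimination.
Variable M : Type.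

Fixpoint gev (S : zmodType) (i : M -> S) n (v : 'I_n -> S) (t : term M n) : S :=
  match t with
  | Var j => v j
  | Par a => i a
  | Zero => 0
  | Opp u => - gev i v u
  | Add u w => gev i v u + gev i v w
  end.

Fixpoint tsplit n (t : term M n.+1) : int * term M n :=
  match t with
  | Var j => if unlift ord0 j is Some k then (0, Var M k) else (1, Zero M n)
  | Par a => (0, Par n a)
  | Zero => (0, Zero M n)
  | Opp u => (- (tsplit u).1, Opp (tsplit u).2)
  | Add u w => ((tsplit u).1 + (tsplit w).1, Add (tsplit u).2 (tsplit w).2)
  end.

Lemma gev_split (S : zmodType) (i : M -> S) n x (v : 'I_n -> S) t :
  gev i (scons x v) t = x *~ (tsplit t).1 + gev i v (tsplit t).2.
Proof.
elim: t => /= [j|a||u IH|u IHu w IHw]; rewrite ?mulr0z ?add0r //.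
- by rewrite /scons; case: unliftP => [k|] _ /=; rewrite ?add0r ?addr0.
- by rewrite IH opprD mulrNz.
- by rewrite IHu IHw mulrzDr addrACA.
Qed.

Definition tmul n (j : nat) (t : term M n) := iter j (Add t) (Zero M n).
Arguments tmul : simpl never.

Lemma gev_tmul (S : zmodType) (i : M -> S) n (v : 'I_n -> S) j t :
  gev i v (tmul j t) = gev i v t *+ j.
Proof. by elim: j => //= j IH; rewrite mulrS -IH. Qed.

(* The root of [t] in the variable x_0, multiplied by N. *)
Definition troot n N (t : term M n.+1) : term M n :=
  let r := tmul (N %/ `|(tsplit t).1|%N) (tsplit t).2 in
  if (tsplit t).1 <= 0 then r else Opp r.

Definition tden n (T : seq (term M n.+1)) : nat :=
  foldr (fun t N => maxn 1 `|(tsplit t).1|%N * N)%N 1%N T.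

Definition telim n (T : seq (term M n.+1)) : seq (term M n) :=
  let R := map (troot (tden T)) T in
  map (fun t => (tsplit t).2) T ++
  map (fun p => Add p.1 (Opp p.2)) (List.list_prod R R).

Lemma tden_gt0 n (T : seq (term M n.+1)) : (0 < tden T)%N.
Proof. by elim: T => //= t T IH; rewrite muln_gt0 IH andbT leq_max. Qed.

Lemma dvdn_tden n (T : seq (term M n.+1)) t : List.In t T -> (tsplit t).1 != 0 ->
  (`|(tsplit t).1|%N %| tden T)%N.
Proof.
elim: T => //= u T IH [<-|tT] t0; last by rewrite dvdn_mull // IH.
by rewrite (maxn_idPr _) ?absz_gt0 // dvdn_mulr.
Qed.

Lemma telim_pars (E : set M) n (T : seq (term M n.+1)) :
  (forall t, List.In t T -> term_pars_in E t) ->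
  forall t, List.In t (telim T) -> term_pars_in E t.
Proof.
have split_pars m (t : term M m.+1) : term_pars_in E t -> term_pars_in E (tsplit t).2.
  elim: t => //= [j|u IHu w IHw [hu hw]]; last by split; [exact: IHu|exact: IHw].
  by case: unliftP.
have tmul_pars m (t : term M m) j : term_pars_in E t -> term_pars_in E (tmul j t).
  by move=> h; elim: j.
have root_pars N t : List.In t T -> (forall t, List.In t T -> term_pars_in E t) ->
    term_pars_in E (troot N t).
  by move=> tT h; rewrite /troot; case: ifP => _ /=; apply/tmul_pars/split_pars/h.
move=> h t /List.in_app_iff[] /List.in_map_iff[].
  by move=> u [<- /h]; exact: split_pars.
move=> [p q] [<- /List.in_prod_iff[/List.in_map_iff[u [<- uT]]
  /List.in_map_iff[w [<- wT]]]] /=.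
by split; exact: root_pars.
Qed.

Lemma gevD (S : zmodType) (D : set S) (i : M -> S) n (v : 'I_n -> S) t :
  divisible_subgroup D -> (forall m, D (i m)) -> (forall j, D (v j)) ->
  D (gev i v t).
Proof.
move=> HD Di Dv.
by elim: t => /= [j|a||u IH|u IHu w IHw];
  [|exact: Di|exact: (dsub0 HD)|exact: (dsubN HD)|exact: (dsubD HD)].
Qed.

Lemma sign_root (S : zmodType) (i : M -> S) N n (v : 'I_n -> S) x
    (t : term M n.+1) : (0 < N)%N -> (tsplit t).1 != 0 -> (`|(tsplit t).1|%N %| N)%N ->
  exists2 j, (0 < j)%N & gev i (scons x v) t *+ j =
    if (tsplit t).1 <= 0 then - (x *+ N - gev i v (troot N t))
    else x *+ N - gev i v (troot N t).
Proof.
move=> N0 k0 /dvdnP[j eN].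
have j0 : (0 < j)%N by move: N0; rewrite eN muln_gt0 => /andP[].
exists j => //; rewrite gev_split /troot.
have -> : (N %/ `|(tsplit t).1|%N = j)%N by rewrite eN mulnK // absz_gt0.
move: k0 eN; set k := (tsplit t).1 => k0 eN.
rewrite mulrnDl; case: ifP => k_le0; rewrite k_le0 /=.
  rewrite gev_tmul opprB addrC; congr (_ + _).
  have -> : k = - (`|k|%N%:Z) by rewrite abszE ler0_norm // opprK.
  by rewrite mulrNz mulNrn -pmulrn -mulrnA eN mulnC.
rewrite gev_tmul opprK; congr (_ + _).
have -> : k = `|k|%N%:Z by rewrite abszE gtr0_norm // ltNge k_le0.
by rewrite -pmulrn -mulrnA eN mulnC.
Qed.

End Elimination.

Section Transfer.
Variables (M : Type) (S S' : zmodType) (D P : set S) (D' P' : set S').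
Hypotheses (H : total_cone D P) (H' : total_cone D' P').
Variables (i : M -> S) (i' : M -> S').
Hypotheses (Di : forall m, D (i m)) (Di' : forall m, D' (i' m)).

Lemma same_signMn s s' j j' : D s -> D' s' -> (0 < j)%N -> (0 < j')%N ->
  same_sign P P' (s *+ j) (s' *+ j') -> same_sign P P' s s'.
Proof.
move=> Ds Ds' j0 j0'; have HD := tc_dom H; have HD' := tc_dom H'.
rewrite /same_sign -!mulNrn (tcMn H j0 Ds) (tcMn H' j0' Ds').
by rewrite (tcMn H j0 (dsubN HD Ds)) (tcMn H' j0' (dsubN HD' Ds')).
Qed.

Lemma telim_extend n (T : seq (term M n.+1)) (v : 'I_n -> S) (v' : 'I_n -> S') x :
  (forall j, D (v j)) -> (forall j, D' (v' j)) -> D x ->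
  (forall t, List.In t (telim T) -> same_sign P P' (gev i v t) (gev i' v' t)) ->
  exists2 x', D' x' & forall t, List.In t T ->
    same_sign P P' (gev i (scons x v) t) (gev i' (scons x' v') t).
Proof.
move=> Dv Dv' Dx hT; have HD := tc_dom H; have HD' := tc_dom H'.
set N := tden T; have N0 : (0 < N)%N := tden_gt0 T.
pose val t := (gev i v (troot N t), gev i' v' (troot N t)).
have [|y' Dy' hy] := @order_iso_extend _ _ _ _ _ _ H H' (map val T)
    (x *+ N) _ (dsubMn N HD Dx).
  move=> _ _ /List.in_map_iff[t [<- tT]] /List.in_map_iff[u [<- uT]] /=.
  split; [exact: gevD|exact: gevD|].
  have [|h _] // := hT (Add (troot N u) (Opp (troot N t))).
  apply/List.in_app_iff; right; apply/List.in_map_iff.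
  exists (troot N u, troot N t); split=> //.
  by apply/List.in_prod_iff; split; apply/List.in_map_iff; [exists u|exists t].
have [x' Dx' ex] := tc_div H' N0 Dy'.
have Dsc m (Y : zmodType) (E : set Y) (z : Y) (w : 'I_m -> Y) :
    E z -> (forall j, E (w j)) -> forall j, E (scons z w j).
  by move=> Ez Ew j; rewrite /scons; case: unliftP.
exists x' => // t tT.
have Dg := gevD t HD Di (Dsc _ _ _ _ _ Dx Dv).
have Dg' := gevD t HD' Di' (Dsc _ _ _ _ _ Dx' Dv').
have [k0|k0] := eqVneq (tsplit t).1 0.
  rewrite !gev_split k0 !mulr0z !add0r; apply: hT.
  by apply/List.in_app_iff; left; apply/List.in_map_iff; exists t.
have [j j0 e] := sign_root i v x N0 k0 (dvdn_tden tT k0).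
have [j' j0' e'] := sign_root i' v' x' N0 k0 (dvdn_tden tT k0).
apply: (same_signMn Dg Dg' j0 j0'); rewrite e e' ex.
have hs := hy (val t) (List.in_map val _ _ tT).
by case: ifP => _ //; exact: same_signN.
Qed.

Lemma scons_eta (Y : Type) m (w : 'I_m.+1 -> Y) :
  w = scons (w ord0) (w \o lift ord0).
Proof. by apply/funext => j; rewrite /scons; case: unliftP => [k|] ->. Qed.

Lemma realize_signs : (forall t : term M 0, forall v v',
    same_sign P P' (gev i v t) (gev i' v' t)) ->
  forall n (T : seq (term M n)) (v : 'I_n -> S), (forall j, D (v j)) ->
  exists2 v' : 'I_n -> S', (forall j, D' (v' j)) &
    forall t, List.In t T -> same_sign P P' (gev i v t) (gev i' v' t).
Proof.
move=> h0; elim=> [|n IH] T v Dv.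
  by exists (fun=> 0) => [|t _]; [case|exact: h0].
have [//|v' Dv' hv] := IH (telim T) (v \o lift ord0).
  by move=> j; exact: Dv.
have [|x' Dx' hx] := telim_extend _ Dv' (Dv ord0) hv; first by move=> j; exact: Dv.
exists (scons x' v').
  by move=> j; rewrite /scons; case: unliftP.
by move=> t tT; rewrite [v]scons_eta; exact: hx.
Qed.

End Transfer.

Section QuantifierElimination.
Variables (M : porderZmodType) (HM : is_doag M).

Definition nonneg : set M := fun x => 0 <= x.

Lemma doag_total_cone : total_cone [set: M]%classic nonneg.
Proof.
rewrite /nonneg; split.
- by split.
- by move=> n x n0 _; have [y yx] := doag_div HM x n0; exists y.
- exact: lexx.
- by move=> x y _ _; exact: doag_addr_ge0.
- by move=> x _; have [|] := orP (doag_total HM 0 x); [left|right; doag_lra HM].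
- have [x x0] := doag_nontriv HM; have [h|h] := orP (doag_total HM 0 x).
    by exists (- x) => // h'; case/eqP: x0; doag_lra HM.
  by exists x => // h'; case/eqP: x0; doag_lra HM.
Qed.

Lemma gev_id n (v : 'I_n -> M) t : gev id v t = eval v t.
Proof. by elim: t => //= [u ->|u -> w ->]. Qed.

Notation same_signM := (same_sign nonneg nonneg).

Lemma quantifier_elimination n (phi : formula M n) :
  exists T : seq (term M n),
    (forall E : set M, pars_in E phi -> forall t, List.In t T -> term_pars_in E t) /\
    forall v v', (forall t, List.In t T -> same_signM (eval v t) (eval v' t)) ->
      (sat phi v <-> sat phi v').
Proof.
elim: phi => {n} n => [t u|t u|phi [T [pT hT]]
  |phi [T [pT hT]] psi [U [pU hU]]|phi [T [pT hT]]].
- exists [:: Add t (Opp u)]; split=> [E /= [ht hu] _ [<-|//]|v v' h]; first by split.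
  have eqE w : eval w t = eval w u <->
      nonneg (eval w t - eval w u) /\ nonneg (- (eval w t - eval w u)).
    rewrite /nonneg opprB !(doag_subr_ge0 HM).
    by split=> [->|[l1 l2]]; [rewrite !lexx|apply/le_anti/andP].
  by have := h _ (or_introl erefl); rewrite /= !eqE /same_sign; tauto.
- exists [:: Add t (Opp u)]; split=> [E /= [ht hu] _ [<-|//]|v v' h]; first by split.
  have ltE w : eval w t < eval w u <-> ~ nonneg (eval w t - eval w u).
    rewrite /nonneg (doag_subr_ge0 HM) (doag_ltNge HM).
    by split=> [/negP|/negP].
  by have := h _ (or_introl erefl); rewrite /= !ltE /same_sign; tauto.
- exists T; split=> // v v' h; have /= := hT _ _ h; tauto.
- exists (T ++ U); split=> [E /= [hphi hpsi] t /List.in_app_iff[]|v v' h].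
  + exact: pT.
  + exact: pU.
  have := hT v v'; have := hU v v' => /=.
  move=> h1 h2; rewrite h1 ?h2 // => t tT; apply: h; apply/List.in_app_iff; tauto.
- exists (telim T); split=> [E /= hphi|].
    by apply: telim_pars; exact: pT.
  have half v v' : (forall t, List.In t (telim T) -> same_signM (eval v t) (eval v' t)) ->
      sat (Ex phi) v -> sat (Ex phi) v'.
    move=> h [x hx].
    have tc := doag_total_cone.
    have [t tT|x' _ hx'] := @telim_extend M M M _ _ _ _ tc tc id id
      (fun=> I) (fun=> I) n T v v' x (fun=> I) (fun=> I) I.
      by rewrite !gev_id; exact: h.
    exists x'; apply/(hT (scons x v)) => // t tT.
    by rewrite -!gev_id; exact: hx'.
  move=> v v' h; split; apply: half => // t tT.
  by have := h t tT; rewrite /same_sign; tauto.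
Qed.

End QuantifierElimination.

Local Open Scope classical_set_scope.
Local Open Scope ring_scope.

(** * The invariant cone on M x C *)

Section AmalgamCone.
Variables (M : porderZmodType) (HM : is_doag M) (A B C K : set M).
Hypotheses (HA : divisible_subgroup A) (HB : divisible_subgroup B).
Hypotheses (HC : divisible_subgroup C).
Hypotheses (sAB : forall a, A a -> B a) (sAC : forall a, A a -> C a).
Hypotheses (HK : cut_cone A C K) (FK : forall z, forced A C B z -> K z).
Hypothesis Ktot : forall z, C z -> K z \/ K (- z).

(* The pair (m, w) stands for the difference of m and a generic copy of w: an
   element w of K lies below the elements of M in its cut over A. *)
Definition amalgam_dom : set (M * M) := fun p => C p.2.

Definition amalgam_cone : set (M * M) := fun p =>
  (exists2 a, A a & p.2 <= a <= p.1) \/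
  K p.2 /\ forall a, A a -> a <= p.2 -> a < p.1.

Lemma amalgam_cone_base m : amalgam_cone (m, 0) <-> 0 <= m.
Proof.
split=> [[[a Aa /= /andP[a0 am]]|[_ /= h]]|m0]; first by doag_lra HM.
  by apply/ltW/h; [exact: (dsub0 HA)|exact: lexx].
by left; exists 0; [exact: (dsub0 HA)|rewrite /= lexx].
Qed.

Lemma amalgam_cone_sub b w : B b -> C w -> amalgam_cone (b, w) <-> w <= b.
Proof.
move=> Bb Cw; split=> [[[a Aa /= /andP[wa ab]]|[/= Kw h]]|wb].
- by doag_lra HM.
- rewrite (doag_leNgt HM); apply/negP => bw.
  have g : gap A b w by move=> a Aa ba /(h _ Aa) ab; doag_lra HM.
  have KNw : K (- w).
    apply: FK; split; first exact: (dsubN HC).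
    exists (- b); first exact: (dsubN HB).
    split; [by doag_lra HM|exact: gapN].
  by apply: (g w); [exact: (cc_anti HK)|exact: ltW|exact: lexx].
- have [g|/gapNP[a Aa h]] := pselect (gap A w b); last by left; exists a.
  right; split=> /=; first by apply: FK; split=> //; exists b.
  move=> a Aa aw; rewrite (doag_ltNge HM); apply/negP => ba.
  have e : a = w by doag_lra HM.
  by apply: (g a) => //; rewrite e ?lexx.
Qed.

Lemma amalgam_coneD p q : amalgam_dom p -> amalgam_dom q ->
  amalgam_cone p -> amalgam_cone q -> amalgam_cone (p + q).
Proof.
have mixed m w n z : C w -> C z -> (exists2 a, A a & w <= a <= m) ->
    (K z /\ forall a, A a -> a <= z -> a < n) -> amalgam_cone (m + n, w + z).
  move=> Cw Cz [a Aa wam] [Kz hz].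
  have [g|/gapNP[b Ab h]] := pselect (gap A (w + z) (a + z)).
    right; split=> /=.
      apply: (cc_down HK _ _ g); first exact: (dsubD HC).
        by doag_lra HM.
      by apply: (ccD HK) => //; exact: (cc_base HK).
    move=> b Ab bz; have := hz (b - a) (dsubB HA Ab Aa).
    have ba : b - a <= z by doag_lra HM.
    by move=> /(_ ba) l; doag_lra HM.
  left; exists b => //=.
  have ba : b - a <= z by doag_lra HM.
  by have l := hz _ (dsubB HA Ab Aa) ba; doag_lra HM.
case: p q => [m w] [n z]; rewrite /amalgam_dom /= => Cw Cz Hp Hq.
rewrite -[(m, w) + (n, z)]/(m + n, w + z).
case: Hp => [[a Aa /= h]|[/= Kw hw]].
  case: Hq => [[b Ab /= h']|Hq]; last by apply: mixed => //; exists a.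
  by left; exists (a + b) => /=; [exact: (dsubD HA)|doag_lra HM].
case: Hq => [Hq|[/= Kz hz]].
  by rewrite (addrC m) (addrC w); exact: mixed.
right; split=> /=; first exact: (ccD HK).
move=> b Ab bwz.
have [g|/gapNP[a Aa h]] := pselect (gap A (b - z) w).
  exfalso; have Cbz : C (b - z) by apply: dsubB => //; exact: sAC.
  have le : b - z <= w by doag_lra HM.
  have KNz : K (- z).
    rewrite -(addKr b (- z)); apply: (ccD HK).
      by apply: (cc_base HK); exact: (dsubN HA).
    exact: (cc_down HK Cbz le g).
  by apply: (g (b - z)) => //; apply: dsubB => //; exact: (cc_anti HK).
have [aw baz] : a <= w /\ b - a <= z by split; doag_lra HM.
have l := hw _ Aa aw; have l' := hz _ (dsubB HA Ab Aa) baz.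
by doag_lra HM.
Qed.

Lemma amalgam_total_cone : total_cone amalgam_dom amalgam_cone.
Proof.
split.
- rewrite /amalgam_dom; split.
  + exact: (dsub0 HC).
  + by move=> x y; exact: (dsubD HC).
  + by move=> x; exact: (dsubN HC).
  + by move=> n x n0; rewrite raddfMn; exact: (dsub_root HC n0).
- move=> n [m w] n0 Cw; have [m' em] := doag_div HM m n0.
  have [w' Cw' ew] := dsub_div HM HC n0 Cw.
  exists (m', w') => //; apply: injective_projections => /=.
    by rewrite (raddfMn fst).
  by rewrite (raddfMn snd).
- by apply/amalgam_cone_base.
- exact: amalgam_coneD.
- move=> [m w] Cw; apply: contrapT => nP.
  have [nP1 nP2] : ~ amalgam_cone (m, w) /\ ~ amalgam_cone (- m, - w) by tauto.
  case: (Ktot Cw) => Kw.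
    apply: nP1; right; split=> //= a Aa aw; rewrite (doag_ltNge HM); apply/negP => ma.
    apply: nP2; left; exists (- a) => /=; first exact: (dsubN HA).
    by doag_lra HM.
  apply: nP2; right; split=> //= a Aa aw; rewrite (doag_ltNge HM); apply/negP => ma.
  apply: nP1; left; exists (- a) => /=; first exact: (dsubN HA).
  by doag_lra HM.
- have [x _ nx] := tc_nontriv (doag_total_cone HM).
  exists (x, 0); first exact: (dsub0 HC).
  by move/amalgam_cone_base.
Qed.

Lemma automorphism_le (s : M -> M) x y : automorphism s -> (s x <= s y) = (x <= y).
Proof. by case=> _ _ h; rewrite !(doag_leNgt HM) h. Qed.

Lemma amalgam_cone_invariant s m w : automorphism_over A s ->
  amalgam_cone (s m, w) <-> amalgam_cone (m, w).
Proof.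
move=> [Hs sA]; have [_ _ slt] := Hs.
split=> [[[a Aa /= /andP[wa am]]|[/= Kw h]]|[[a Aa /= /andP[wa am]]|[/= Kw h]]].
- by left; exists a => //=; rewrite wa -(automorphism_le _ _ Hs) sA.
- by right; split=> //= a Aa aw; rewrite -slt sA //; exact: h.
- by left; exists a => //=; rewrite wa -(sA a Aa) automorphism_le.
- by right; split=> //= a Aa aw; rewrite -(sA a Aa) slt; exact: h.
Qed.

End AmalgamCone.

(** * Automorphisms *)

Section Automorphisms.
Variables (M : porderZmodType) (A : set M).

Lemma automorphism_over_inv s : automorphism_over A s ->
  exists s', [/\ automorphism_over A s', cancel s s' & cancel s' s].
Proof.
move=> [[[s' ss' s's] sB slt] sA]; exists s'; split=> //; split; [split|].
- by exists s.
- by move=> x y; apply: (can_inj ss'); rewrite sB !s's.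
- by move=> x y; rewrite -slt !s's.
- by move=> a Aa; rewrite -{1}(sA a Aa) ss'.
Qed.

Lemma formula_map_cancel s s' n (phi : formula M n) :
  cancel s s' -> formula_map s' (formula_map s phi) = phi.
Proof.
move=> ss'; have tE m (t : term M m) : term_map s' (term_map s t) = t.
  by elim: t => /= [i|a||u ->|u -> w ->] //; rewrite ss'.
by elim: phi => /= [m t u|m t u|m psi ->|m psi -> chi ->|m psi ->] //; rewrite !tE.
Qed.

Lemma automorphismE (s : M -> M) : automorphism s ->
  [/\ s 0 = 0, (forall x, s (- x) = - s x) & forall x y, s (x + y) = s x + s y].
Proof.
move=> [_ sB _]; have s0 : s 0 = 0 by have := sB 0 0; rewrite !subrr.
have sN x : s (- x) = - s x by rewrite -[- x]sub0r sB s0 sub0r.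
by split=> // x y; rewrite -{1}[y]opprK sB sN opprK.
Qed.

Lemma eval_map s n (t : term M n) v : automorphism s ->
  eval (s \o v) (term_map s t) = s (eval v t).
Proof.
move=> /automorphismE[s0 sN sD].
by elim: t => /= [i|a||u ->|u -> w ->] //; rewrite ?sN ?sD.
Qed.

Lemma sat_map s n (phi : formula M n) v : automorphism s ->
  sat (formula_map s phi) (s \o v) <-> sat phi v.
Proof.
move=> Hs; have [sb _ slt] := Hs; have [s' ss' s's] := sb.
elim: phi v => /= [m t u|m t u|m psi IH|m psi IH chi IH'|m psi IH] v.
- by rewrite !eval_map //; split=> [/(can_inj ss')|->].
- by rewrite !eval_map // slt.
- by rewrite IH.
- by rewrite IH IH'.
- have sc x : scons (s x) (s \o v) = s \o scons x v.
    by apply/funext => j; rewrite /scons /=; case: unliftP.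
  split=> [[x]|[x /IH]]; last by rewrite -sc; exists (s x).
  by rewrite -[x]s's sc IH; exists (s' x).
Qed.

End Automorphisms.

Lemma finite_set_list (T : Type) (X : set T) :
  finite_set X -> exists l : seq T, forall x, X x -> List.In x l.
Proof.
elim/Peq: T => T in X *; move=> /finite_seqP[l ->]; exists l => x /=.
elim: l => //= a l IH; rewrite inE => /orP[/eqP->|/IH]; [by left|by right].
Qed.

(** * The two implications *)

Section Backward.
Variables (M : porderZmodType) (HM : is_doag M) (A B C : set M).
Hypotheses (HA : divisible_subgroup A) (HB : divisible_subgroup B).
Hypotheses (HC : divisible_subgroup C).
Hypotheses (sAB : forall a, A a -> B a) (sAC : forall a, A a -> C a).

Notation par := (fun m : M => (m, 0 : M)).

Section GenericType.
Variable K : set M.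
Hypotheses (HK : cut_cone A C K) (FK : forall z, forced A C B z -> K z).
Hypothesis Ktot : forall z, C z -> K z \/ K (- z).
Variables (n : nat) (c : 'I_n -> M).
Hypothesis Cc : forall i, C (c i).

Let v0 (i : 'I_n) : M * M := (0, - c i).
Let P := amalgam_cone A K.
Let HP := amalgam_total_cone HM HA HC sAC HK Ktot.

Definition signs_agree (T : seq (term M n)) (v : 'I_n -> M) :=
  forall t, List.In t T -> same_sign P (@nonneg M) (gev par v0 t) (eval v t).

Definition generic_type : set (formula M n) :=
  fun phi => exists T, forall v, signs_agree T v -> sat phi v.

Lemma v0_dom i : amalgam_dom C (v0 i).
Proof. exact: (dsubN HC). Qed.

Lemma par_dom m : amalgam_dom C (par m).
Proof. exact: (dsub0 HC). Qed.

Lemma signs_agree_ex T : exists v, signs_agree T v.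
Proof.
have [t v v'|v _ hv] := realize_signs HP (doag_total_cone HM)
    (i := par) (i' := id) par_dom (fun=> I) _ T v0_dom.
  have -> : gev par v t = (gev id v' t, 0).
    elim: t => /= [[]//|a||u ->|u -> w ->] //;
      by apply: injective_projections => //=; rewrite ?oppr0 ?addr0.
  split; first exact: (amalgam_cone_base HM K HA).
  rewrite (_ : - _ = (- gev id v' t, 0)); first exact: (amalgam_cone_base HM K HA).
  by apply: injective_projections => //=; rewrite oppr0.
by exists v => t tT; rewrite -gev_id; exact: hv.
Qed.

Lemma signs_agree_cat T T' v :
  signs_agree (T ++ T') v <-> signs_agree T v /\ signs_agree T' v.
Proof.
split=> [h|[h h'] t /List.in_app_iff[]]; [|exact: h|exact: h'].
by split=> t tT; apply: h; apply/List.in_app_iff; [left|right].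
Qed.

Lemma generic_type_global : global_type generic_type.
Proof.
split=> [s /finite_set_list[l sl] sp|phi].
  have [T hT] : exists T, forall v, signs_agree T v ->
      forall phi, List.In phi l -> generic_type phi -> sat phi v.
    elim: l {sl} => [|phi l [T hT]]; first by exists [::].
    have [[U hU]|nphi] := pselect (generic_type phi).
      exists (U ++ T) => v /signs_agree_cat[vU vT] psi [<- _|]; [exact: hU|exact: hT].
    by exists T => v vT psi [<-//|]; exact: hT.
  have [v vT] := signs_agree_ex T.
  by exists v => phi sphi; apply: (hT v vT); [exact: sl|exact: sp].
have [T [_ hT]] := quantifier_elimination HM phi.
have [v vT] := signs_agree_ex T.
have same w : signs_agree T w -> (sat phi v <-> sat phi w).
  move=> wT; apply: hT => t tT; have := vT t tT; have := wT t tT.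
  by rewrite /same_sign; tauto.
by have [h|h] := pselect (sat phi v); [left|right];
  exists T => w /same /=; tauto.
Qed.

Lemma generic_type_tp : (tp c (A `|` B) `<=` generic_type)%classic.
Proof.
move=> phi [pphi cphi]; have [T [pT hT]] := quantifier_elimination HM phi.
exists T => v vT; apply/(hT c v) => // t tT; have := vT t tT.
have [b [z [Bb Cz -> ->]]] : exists b z, [/\ B b, C z, gev par v0 t = (b, - z) &
    eval c t = b + z].
  elim: t {tT} (pT _ pphi t tT) => /=
    [i _|a AB_a|_|u IH /IH|u IHu w IHw [/IHu hu /IHw hw]].
  - by exists 0, (c i); rewrite add0r; split=> //; exact: (dsub0 HB).
  - exists a, 0; rewrite oppr0 addr0; split=> //; last exact: (dsub0 HC).
    by case: AB_a => // /sAB.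
  - by exists 0, 0; rewrite oppr0 addr0; split=> //;
      [exact: (dsub0 HB)|exact: (dsub0 HC)].
  - move=> [b [z [Bb Cz -> ->]]]; exists (- b), (- z).
    by rewrite -opprD; split=> //; [exact: (dsubN HB)|exact: (dsubN HC)].
  - have [b [z [Bb Cz -> ->]]] := hu; have [b' [z' [Bb' Cz' -> ->]]] := hw.
    exists (b + b'), (z + z'); rewrite addrACA opprD.
    by split=> //; [exact: (dsubD HB)|exact: (dsubD HC)].
have E b' z' : B b' -> C z' -> P (b', - z') <-> nonneg (b' + z').
  move=> Bb' Cz'; rewrite /P (amalgam_cone_sub HM HA HB HC HK FK) //;
    last exact: (dsubN HC).
  by rewrite /nonneg; split=> h; doag_lra HM.
have := E _ _ (dsubN HB Bb) (dsubN HC Cz); have := E _ _ Bb Cz.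
rewrite -opprD /same_sign -[- (b, - z)]/(- b, - - z).
by tauto.
Qed.

Lemma generic_type_map s phi : automorphism_over A s ->
  generic_type phi -> generic_type (formula_map s phi).
Proof.
move=> Hs [T hT]; exists (map (@term_map M s n) T) => v hv.
have [s' [_ ss' s's]] := automorphism_over_inv Hs.
have [Has _] := Hs; have [s0 sN sD] := automorphismE Has.
have ev : v = s \o (s' \o v) by apply/funext => i /=; rewrite s's.
rewrite ev; apply/sat_map => //; apply: hT => t tT.
have := hv _ (List.in_map _ _ _ tT); rewrite {1}ev eval_map //.
have [m [z [e1 e2]]] : exists m z, gev par v0 t = (m, z) /\
    gev par v0 (term_map s t) = (s m, z).
  elim: t {tT} => /= [i|a||u [m [z [-> ->]]]|u [m [z [-> ->]]] w [m' [z' [-> ->]]]].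
  - by exists 0, (- c i); rewrite s0.
  - by exists a, 0.
  - by exists 0, 0; rewrite s0.
  - by exists (- m), (- z); rewrite sN.
  - by exists (m + m'), (z + z'); rewrite sD.
have nn x : nonneg (s x) <-> nonneg x by rewrite /nonneg -{1}s0 (automorphism_le HM).
rewrite e1 e2 /same_sign (_ : - (s m, z) = (s (- m), - z)); last first.
  by apply: injective_projections => //=; rewrite sN.
by rewrite -sN !nn /P !(amalgam_cone_invariant HM _ _ _ Hs).
Qed.

Lemma generic_type_invariant : invariant_over A generic_type.
Proof.
move=> s Hs phi; split; last exact: generic_type_map.
have [s' [Hs' ss' _]] := automorphism_over_inv Hs.
by move/(generic_type_map Hs'); rewrite formula_map_cancel.
Qed.

End GenericType.

Lemma cut_indep_inv_indep : cut_indep C A B -> inv_indep C A B.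
Proof.
move=> Hcut n c Cc.
have [|K [HK FK Ktot]] := total_cut_cone HM HA HC sAC HB sAB.
  move=> b1 b2 d Bb1 Bb2 Cd l1 l2 g.
  have [||a Aa /andP[]] := Hcut b1 b2 Bb1 Bb2; last exact: g Aa.
    exact: le_trans l2.
  by exists d => //; rewrite l1.
exists (generic_type K c); split.
- exact: generic_type_global.
- exact: generic_type_tp.
- exact: generic_type_invariant.
Qed.

End Backward.

Section Forward.
Variables (M : porderZmodType) (HM : is_doag M) (A B C : set M).
Hypotheses (HA : divisible_subgroup A).
Hypotheses (sAB : forall a, A a -> B a).

Lemma gap_same_sign a b y k : A a -> b <= y -> gap A b y ->
  nonneg (a + b *~ k) <-> nonneg (a + y *~ k).
Proof.
rewrite /nonneg => Aa byy g.
have pos m : (0 < m)%N -> (0 <= a + b *+ m <-> 0 <= a + y *+ m) /\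
    (0 <= a - b *+ m <-> 0 <= a - y *+ m).
  move=> m0; have [a' Aa' ea] := dsub_div HM HA m0 Aa.
  have E x : (0 <= a + x *+ m) = (- a' <= x).
    by rewrite -[RHS](doag_lerMn HM _ _ m0) mulNrn ea; apply/idP/idP => ?; doag_lra HM.
  have E' x : (0 <= a - x *+ m) = (x <= a').
    by rewrite -[RHS](doag_lerMn HM _ _ m0) ea; apply/idP/idP => ?; doag_lra HM.
  rewrite !E !E'; split; split=> h.
  - exact: le_trans h byy.
  - rewrite (doag_leNgt HM); apply/negP => l.
    by apply: (g (- a')) => //; [exact: (dsubN HA)|exact: ltW].
  - rewrite (doag_leNgt HM); apply/negP => l.
    by apply: (g a') => //; exact: ltW.
  - exact: le_trans byy h.
case: k => m; last by rewrite !NegzE !mulrNz -!pmulrn; case: (pos m.+1).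
by case: m => [|m]; [rewrite !mulr0z|rewrite -!pmulrn; case: (pos m.+1)].
Qed.

Lemma gap_partial_elementary b y f : b <= y -> gap A b y ->
  (forall a, A a -> f a = a) -> f b = y ->
  partial_elementary (fun x => A x \/ x = b) f.
Proof.
move=> byy g fA fb n phi d phi0 Dd.
have [T [pT hT]] := quantifier_elimination HM phi.
apply: hT => t /(pT _ phi0) t0.
have [a [k [Aa -> ->]]] : exists a k, [/\ A a, eval d t = a + b *~ k &
    eval (f \o d) t = a + y *~ k].
  elim: t t0 => /= [i _|//|_|u IH /IH|u IHu w IHw [/IHu hu /IHw hw]].
  - have [Ai|->] := Dd i.
      by exists (d i), 0; rewrite !mulr0z !addr0 fA.
    by exists 0, 1; rewrite !add0r fb; split=> //; exact: (dsub0 HA).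
  - by exists 0, 0; rewrite !mulr0z !addr0; split=> //; exact: (dsub0 HA).
  - move=> [a [k [Aa -> ->]]]; exists (- a), (- k).
    by rewrite !mulrNz !opprD; split=> //; exact: (dsubN HA).
  - have [a [k [Aa -> ->]]] := hu; have [a' [k' [Aa' -> ->]]] := hw.
    exists (a + a'), (k + k'); rewrite !mulrzDr ![a + _ + (a' + _)]addrACA.
    by split=> //; exact: (dsubD HA).
split; first exact: gap_same_sign.
rewrite !opprD -!mulrNz; apply: gap_same_sign => //; exact: (dsubN HA).
Qed.

Definition right_cut b : set (formula M 1) := fun phi =>
  phi = Lt (Par 1 b) (Var M ord0) \/
  exists a, [/\ A a, b < a & phi = Lt (Var M ord0) (Par 1 a)].

Lemma right_cut_fin_sat b : finitely_satisfiable (right_cut b).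
Proof.
move=> s /finite_set_list[l sl] sp.
have mid (x y : M) : x < y -> exists2 z, x < z & z < y.
  move=> xy; have [z ez] := doag_div HM (x + y) (isT : (0 < 2)%N).
  by exists z; doag_lra HM.
have [u bu hu] : exists2 u, b < u & forall y, b < y -> y < u ->
    forall phi, List.In phi l -> right_cut b phi -> sat phi (fun=> y).
  elim: l {sl} => [|phi l [u bu hu]].
    have [x _ nx] := tc_nontriv (doag_total_cone HM).
    exists (b - x); last by [].
    move/negP: nx; rewrite -(doag_ltNge HM) => ?; doag_lra HM.
  have [[a [Aa ba ephi]]|nphi] := pselect
      (exists a, [/\ A a, b < a & phi = Lt (Var M ord0) (Par 1 a)]).
    have [le|le] := orP (doag_total HM a u).
      exists a => // y by_ ya psi [<- _|psil]; first by rewrite ephi.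
      apply: hu => //; exact: lt_le_trans le.
    exists u => // y by_ yu psi [<- _|psil]; last exact: hu.
    by rewrite ephi /=; exact: lt_le_trans le.
  exists u => // y by_ yu psi [<- [->|]//|psil]; last exact: hu.
have [y by_ yu] := mid _ _ bu.
by exists (fun=> y) => phi sphi; apply: (hu y by_ yu); [exact: sl|exact: sp].
Qed.

Lemma inv_indep_cut_indep :
  succ_saturated (B `|` C) -> strongly_succ_homogeneous (B `|` C) ->
  inv_indep C A B -> cut_indep C A B.
Proof.
move=> Hsat Hhom Hinv b1 b2 Bb1 Bb2 b12 [c Cc /andP[b1c cb2]].
apply: contrapT => nA.
have g : gap A b1 b2.
  by move=> a Aa l1 l2; apply: nA; exists a => //; rewrite l1.
have [||y hy] := Hsat B _ (right_cut b2) _ (@right_cut_fin_sat b2).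
- by apply: subset_card_le; exact: subsetUl.
- by move=> _ [->//|[a [Aa _ ->]]] /=; split=> //; exact: sAB.
have b2y : b2 < y by apply: (hy (Lt (Par 1 b2) (Var M ord0))); left.
have g' : gap A b1 y.
  move=> a Aa l1 l2; have [l3|l3] := boolP (a <= b2); first exact: g Aa l1 l3.
  rewrite -(doag_ltNge HM) in l3.
  have /= l4 : sat (Lt (Var M ord0) (Par 1 a)) (fun=> y).
    by apply: hy; right; exists a.
  by doag_lra HM.
have nA1 : ~ A b1 by move=> Ab; exact: g Ab (lexx _) b12.
pose f x := if pselect (A x) then x else y.
have fA a : A a -> f a = a by rewrite /f; case: pselect.
have fb : f b1 = y by rewrite /f; case: pselect.
have b1y : b1 <= y by doag_lra HM.
have [||s [Hs sf]] := Hhom (fun x => A x \/ x = b1) _ f.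
- by apply: subset_card_le => x [Ax|->]; left => //; exact: sAB.
- exact: (gap_partial_elementary b1y g' fA fb).
have HsA : automorphism_over A s.
  by split=> // a Aa; rewrite sf ?fA //; left.
have sb : s b1 = y by rewrite sf ?fb //; right.
have [p [[pfin _] ptp pinv]] := Hinv 1%N (fun=> c) (fun=> Cc).
pose phi1 := Not (Lt (Var M ord0) (Par 1 b1)).
pose phi2 := Not (Lt (Par 1 b2) (Var M ord0)).
have p1 : p (formula_map s phi1).
  apply/pinv => //; apply: ptp; split=> /=; first by split=> //; right.
  by rewrite (rwP negP) -(doag_leNgt HM).
have p2 : p phi2.
  apply: ptp; split=> /=; first by split=> //; right.
  by rewrite (rwP negP) -(doag_leNgt HM).
have [|_ [->|->]//|v hv] := pfin [set formula_map s phi1; phi2].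
  exact: finite_set2.
have := hv _ (or_introl erefl); have := hv _ (or_intror erefl) => /=.
rewrite sb !(rwP negP) -!(doag_leNgt HM) => l1 l2.
have : b2 < b2 by doag_lra HM.
by rewrite ltxx.
Qed.

End Forward.

Theorem theorem3p1p5 (M : porderZmodType) (A B C : set M) :
  is_doag M ->
  Qsubspace A -> Qsubspace B -> Qsubspace C ->
  A `<=` B -> A `<=` C ->
  succ_saturated (B `|` C) ->
  strongly_succ_homogeneous (B `|` C) ->
  inv_indep C A B <-> cut_indep C A B.
Proof.
move=> HM /Qsubspace_divisible HA /Qsubspace_divisible HB /Qsubspace_divisible HC.
move=> sAB sAC Hsat Hhom; split; first exact: inv_indep_cut_indep.
exact: cut_indep_inv_indep.
Qed.
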